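(* Consider the L-Katyusha iteration (defined in the context) with probability $p\in(0,1]$ and sampling (or sampling with replacement) $S$. Suppose: (1) there are $L_f>0$, $\mu_f\ge 0$, $\mu_\psi\ge 0$ with $\mu:=\mu_f+\mu_\psi>0$ such that $\frac{L_f}{2}\|x\|^2-f(x)$, $f(x)-\frac{\mu_f}{2}\|x\|^2$ and $\psi(x)-\frac{\mu_\psi}{2}\|x\|^2$ are convex; (2) there is a constant $\mathcal{L}_2>0$ such that for all $x,y\in\mathbb{R}^d$ $$\mathbb{E}\left[\left\|\tfrac1n(\mathbf{G}(x)-\mathbf{G}(y))\theta_S\mathbf{I}_Se-\tfrac1n(\mathbf{G}(x)-\mathbf{G}(y))e\right\|^2\right]\le 2\mathcal{L}_2\left(f(x)-f(y)-\langle\nabla f(y),x-y\rangle\right).$$ For $0<q<1$ let $$\mathcal{Z}^k=\frac{L(1+\eta\sigma)}{2\eta}\|z^k-x^*\|^2,\quad \mathcal{Y}^k=\frac{1}{\theta_1}(P(y^k)-P(x^* )),\quad \mathcal{W}^k=\frac{\theta_2}{pq\theta_1}(P(w^k)-P(x^* )),$$ and $\Psi^k=\mathcal{Z}^k+\mathcal{Y}^k+\mathcal{W}^k$. Then for every $k\ge 0$ $$\mathbb{E}_k[\mathcal{Z}^{k+1}+\mathcal{Y}^{k+1}+\mathcal{W}^{k+1}]\le\frac{1}{1+\eta\sigma}\mathcal{Z}^k+\left(1-\left(\theta_1+\theta_2-\frac{\theta_2}{q}\right)\right)\mathcal{Y}^k+(1-p(1-q))\mathcal{W}^k.$$ Moreover,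 for some $q\in[\frac23,1)$ one has, for $\epsilon\in(0,1)$, $\mathbb{E}[\Psi^k]\le\epsilon\Psi^0$ for $$k\ge O\left(\left(\frac1p+\sqrt{\frac{L_f}{\mu}}+\sqrt{\frac{\mathcal{L}_2}{\mu p}}\right)\log\frac1\epsilon\right),$$ where $O(\cdot)$ hides an absolute constant.
   Context: Problem: minimize $P(x)=f(x)+\psi(x)$ over $x\in\mathbb{R}^d$, where $f=\frac1n\sum_{i=1}^nf_i$, each $f_i:\mathbb{R}^d\to\mathbb{R}$ is differentiable, and $\psi:\mathbb{R}^d\to\mathbb{R}\cup\{+\infty\}$ is proper, closed and convex. $P$ has at least one global minimizer; $x^*$ denotes one. The individual $f_i$ need not be convex. Sampling: $[n]=\{1,\dots,n\}$ and $e\in\mathbb{R}^n$ is the all-ones vector. $S$ is one of the following. (a) A proper sampling: a random subset of $[n]$ with $\mathbb{P}[i\in S]>0$ for all $i$, together with real weights $\theta_C^i$ ($i\in[n]$, $C\subseteq[n]$). (b) A sampling with replacement: $S$ consists of $\tau$ independent copies of an index drawn from a distribution on $[n]$ with probabilities $\tilde p_i>0$ (repetitions counted), with weights $\theta_S^i=1/(\tau\tilde p_i)$. $\theta_S$ is the $n\times n$ diagonal matrix with diagonal entries $\theta_S^i$, and $\mathbf{I}_S$ is the diagonal matrix whose $i$-th diagonal entry is the number of copies of $i$ in $S$. It is assumed that $\mathbb{E}[\theta_S\mathbf{I}_S]e=e$ (automatic in case (b)). $\mathbf{G}(x)=[\nabla f_1(x),\dots,\nabla f_n(x)]\in\mathbb{R}^{d\times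 n}$, so $\frac1n\mathbf{G}(x)\theta_S\mathbf{I}_Se=\frac1n\sum_{i\in S}\theta_S^i\nabla f_i(x)$ with multiplicities. Proximal operator: $\mathrm{prox}_\eta(x)=\arg\min_y\{\frac{1}{2\eta}\|x-y\|^2+\psi(y)\}$. L-Katyusha parameters: $L=\max\{\mathcal{L}_2,L_f\}$, $\sigma_1=\frac{\mu_f}{L}$, $\sigma_2=\frac{\mu_\psi}{L}$, $\sigma=\frac{\mu}{L}$, $\theta_2=\frac{\mathcal{L}_2}{2L}$; if $L_f\le\frac{\mathcal{L}_2}{p}$ then $\theta_1=\min\left\{\sqrt{\frac{\mu}{\mathcal{L}_2p}}\,\theta_2,\theta_2\right\}$, otherwise $\theta_1=\min\left\{\sqrt{\frac{\mu}{L_f}},\frac p2\right\}$; $\eta=\frac{1}{3\theta_1}$. L-Katyusha: $y^0=z^0=w^0\in\mathbb{R}^d$. For $k=0,1,2,\dots$: $x^k=\theta_1z^k+\theta_2w^k+(1-\theta_1-\theta_2)y^k$; draw $S_k$ as a fresh independent copy of $S$; $g^k=\frac1n(\mathbf{G}(x^k)-\mathbf{G}(w^k))\theta_{S_k}\mathbf{I}_{S_k}e+\frac1n\mathbf{G}(w^k)e$; $z^{k+1}=\mathrm{prox}_{\frac{\eta}{(1+\eta\sigma_1)L}}\left(\frac{1}{1+\eta\sigma_1}\left(\eta\sigma_1x^k+z^k-\frac{\eta}{L}g^k\right)\right)$; $y^{k+1}=x^k+\theta_1(z^{k+1}-z^k)$; $w^{k+1}=y^k$ with probability $p$ and $w^{k+1}=w^k$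 with probability $1-p$ (by an independent coin flip). $\mathbb{E}_k[\cdot]$ is the expectation conditional on the state $(y^k,z^k,w^k)$ at the start of iteration $k$. *)

(* Defs.v *)
From HB Require Import structures.
From mathcomp Require Import all_boot all_order all_algebra finmap.
From mathcomp Require Import all_classical all_reals all_analysis.
Set Implicit Arguments.
Unset Strict Implicit.
Unset Printing Implicit Defensive.
Import Order.TTheory GRing.Theory Num.Theory.
Import numFieldNormedType.Exports.
Local Open Scope classical_set_scope.
Local Open Scope ring_scope.

(* The library norm on matrices is the sup norm.  It is only used for the
   topology and differentiability, which do not depend on the norm; every
   quantitative norm is the Euclidean one below. *)
Definition dot (R : realType) (d : nat) (u v : 'cV[R]_d) : R :=
  \sum_(i < d) u i 0 * v i 0.

Definition sqnorm (R : realType) (d : nat) (u : 'cV[R]_d) : R := dot u u.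

Definition grad (R : realType) (d : nat) (g : 'cV[R]_d -> R) (x : 'cV[R]_d) :
  'cV[R]_d := \col_(j < d) 'D_(delta_mx j 0) g x.

Definition ones (R : realType) (n : nat) : 'cV[R]_n := const_mx 1.

(* In [\bar R], [0 * +oo = 0] and [+oo - r%:E = +oo]; this is only applied to
   functions that avoid [-oo]. *)
Definition convex_efun (R : realType) (d : nat) (g : 'cV[R]_d -> \bar R) : Prop :=
  forall (t : R) (x y : 'cV[R]_d), 0 <= t <= 1 ->
    (g (t *: x + (1 - t) *: y)%R <= t%:E * g x + (1 - t)%:E * g y)%E.

Definition proper_efun (R : realType) (d : nat) (g : 'cV[R]_d -> \bar R) : Prop :=
  (forall x, g x != -oo%E) /\ (exists x, g x != +oo%E).

Definition closed_efun (R : realType) (d : nat) (g : 'cV[R]_d -> \bar R) : Prop :=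
  closed [set xr : 'cV[R]_d * R | (g xr.1 <= xr.2%:E)%E].

(* [xget] selects an element of the argmin set, with a dummy value should that
   set be empty; for [psi] proper, closed and convex and [h > 0] the argmin set
   is a singleton. *)
Definition prox (R : realType) (d : nat) (psi : 'cV[R]_d -> \bar R) (h : R)
    (x : 'cV[R]_d) : 'cV[R]_d :=
  let obj y := (((2 * h)^-1 * sqnorm (x - y)%R)%:E + psi y)%E in
  xget x [set y | forall u, (obj y <= obj u)%E].

Definition favg (R : realType) (d n : nat) (f : 'I_n -> 'cV[R]_d -> R)
  (x : 'cV[R]_d) : R := n%:R^-1 * \sum_(i < n) f i x.

Definition objective (R : realType) (d n : nat) (f : 'I_n -> 'cV[R]_d -> R)
    (psi : 'cV[R]_d -> \bar R) (x : 'cV[R]_d) : \bar R :=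
  ((favg f x)%:E + psi x)%E.

Definition Gmx (R : realType) (d n : nat) (f : 'I_n -> 'cV[R]_d -> R)
    (x : 'cV[R]_d) : 'M[R]_(d, n) :=
  \matrix_(i < d, j < n) grad (f j) x i 0.

(* The law of a random sample [S] together with its weights: [mult s i] is the
   number of copies of [i] in the sample [s], and [weight s i] is [theta_s^i]. *)
Record sampling (R : realType) (n : nat) := Sampling {
  sample : finType;
  prob : sample -> R;
  mult : sample -> 'I_n -> nat;
  weight : sample -> 'I_n -> R }.

Definition set_sampling (R : realType) (n : nat) (q : {set 'I_n} -> R)
    (theta : 'I_n -> {set 'I_n} -> R) : sampling R n :=
  @Sampling R n {set 'I_n} q
    (fun C i => nat_of_bool (i \in C)) (fun C i => theta i C).

Definition replacement_sampling (R : realType) (n tau : nat) (pt : 'I_n -> R) :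
    sampling R n :=
  @Sampling R n (tau.-tuple 'I_n)
    (fun s => \prod_(j < tau) pt (tnth s j))
    (fun s i => count_mem i s)
    (fun _ i => (tau%:R * pt i)^-1).

Variant sampling_spec (R : realType) (n : nat) : sampling R n -> Prop :=
| ProperSampling (q : {set 'I_n} -> R) (theta : 'I_n -> {set 'I_n} -> R) :
    (forall C, 0 <= q C) -> \sum_(C : {set 'I_n}) q C = 1 ->
    (forall i, 0 < \sum_(C : {set 'I_n} | i \in C) q C) ->
    sampling_spec (set_sampling q theta)
| SamplingWithReplacement (tau : nat) (pt : 'I_n -> R) :
    (0 < tau)%N -> (forall i, 0 < pt i) -> \sum_(i < n) pt i = 1 ->
    sampling_spec (replacement_sampling tau pt).

Definition theta_mx (R : realType) (n : nat) (S : sampling R n) (s : sample S) :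
  'M[R]_n := diag_mx (\row_(i < n) weight s i).

Definition I_mx (R : realType) (n : nat) (S : sampling R n) (s : sample S) :
  'M[R]_n := diag_mx (\row_(i < n) (mult s i)%:R).

Definition unbiased (R : realType) (n : nat) (S : sampling R n) : Prop :=
  (\sum_(s : sample S) prob s *: (theta_mx s *m I_mx s)) *m ones R n = ones R n.

Definition sampled (R : realType) (d n : nat) (S : sampling R n)
    (A : 'M[R]_(d, n)) (s : sample S) : 'cV[R]_d :=
  n%:R^-1 *: (A *m theta_mx s *m I_mx s *m ones R n).

Definition averaged (R : realType) (d n : nat) (A : 'M[R]_(d, n)) : 'cV[R]_d :=
  n%:R^-1 *: (A *m ones R n).

Definition sampling_variance (R : realType) (d n : nat) (S : sampling R n)
    (A : 'M[R]_(d, n)) : R :=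
  \sum_(s : sample S) prob s * sqnorm (sampled A s - averaged A).

(* [pw] is the probability [p] with which [w] is updated. *)
Record constants (R : realType) := Constants {
  Lf : R; mu_f : R; mu_psi : R; L2 : R; pw : R }.

Section parameters.
Context {R : realType}.
Variable c : constants R.

Definition mu : R := mu_f c + mu_psi c.
Definition Lmax : R := Num.max (L2 c) (Lf c).
Definition sigma1 : R := mu_f c / Lmax.
Definition sigma2 : R := mu_psi c / Lmax.
Definition sigma : R := mu / Lmax.
Definition theta2 : R := L2 c / (2 * Lmax).
Definition theta1 : R :=
  if Lf c <= L2 c / pw c
  then Num.min (Num.sqrt (mu / (L2 c * pw c)) * theta2) theta2
  else Num.min (Num.sqrt (mu / Lf c)) (pw c / 2).
Definition eta_ : R := (3 * theta1)^-1.

End parameters.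

Record state (R : realType) (d : nat) := State {
  yk : 'cV[R]_d; zk : 'cV[R]_d; wk : 'cV[R]_d }.

Definition xk (R : realType) (d : nat) (c : constants R) (st : state R d) :
    'cV[R]_d :=
  theta1 c *: zk st + theta2 c *: wk st + (1 - theta1 c - theta2 c) *: yk st.

Definition gk (R : realType) (d n : nat) (f : 'I_n -> 'cV[R]_d -> R)
    (S : sampling R n) (c : constants R) (st : state R d) (s : sample S) :
    'cV[R]_d :=
  sampled (Gmx f (xk c st) - Gmx f (wk st)) s + averaged (Gmx f (wk st)).

Definition step (R : realType) (d n : nat) (f : 'I_n -> 'cV[R]_d -> R)
    (psi : 'cV[R]_d -> \bar R) (S : sampling R n) (c : constants R)
    (st : state R d) (s : sample S) (coin : bool) : state R d :=
  let x := xk c st in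
  let a := 1 + eta_ c * sigma1 c in
  let z' := prox psi (eta_ c / (a * Lmax c))
    (a^-1 *: ((eta_ c * sigma1 c) *: x + zk st
              - (eta_ c / Lmax c) *: gk f c st s)) in
  State (x + theta1 c *: (z' - zk st)) z' (if coin then yk st else wk st).

Fixpoint iterates (R : realType) (d n : nat) (f : 'I_n -> 'cV[R]_d -> R)
    (psi : 'cV[R]_d -> \bar R) (S : sampling R n) (c : constants R)
    (v0 : 'cV[R]_d) (s : nat -> sample S) (b : nat -> bool) (k : nat) :
    state R d :=
  if k is k'.+1 then step f psi c (iterates f psi c v0 s b k') (s k') (b k')
  else State v0 v0 v0.

(* The [S_ k] are distributed as [S], the [B_ k] are Bernoulli with parameter
   [p], and all of them are mutually independent: joint laws of finite
   subfamilies are products (one-element subfamilies give the marginals). *)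
Definition independent_draws (R : realType) (n : nat) (dsp : measure_display)
    (T : measurableType dsp) (Pr : probability T R) (S : sampling R n) (p : R)
    (S_ : nat -> T -> sample S) (B_ : nat -> T -> bool) : Prop :=
  [/\ forall k s, measurable (S_ k @^-1` [set s]),
      forall k b, measurable (B_ k @^-1` [set b]) &
      forall (J J' : {fset nat}) (s : nat -> sample S) (b : nat -> bool),
        Pr ((\bigcap_(k in [set` J]) (S_ k @^-1` [set s k])) `&`
            (\bigcap_(k in [set` J']) (B_ k @^-1` [set b k])))
        = ((\prod_(k <- J) prob (s k)) *
           (\prod_(k <- J') bernoulli_pmf p (b k)))%:E].

(* The library expectation ['E_P[X]] is for real-valued [X]; the functions [X]
   here may take the value [+oo]. *)
Definition mean (R : realType) (dsp : measure_display) (T : measurableType dsp)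
    (Pr : probability T R) (X : T -> \bar R) : \bar R :=
  (\int[Pr]_t X t)%E.

(* Expectation of [X] conditional on an event [A] with [Pr A > 0]. *)
Definition cond_mean (R : realType) (dsp : measure_display)
    (T : measurableType dsp) (Pr : probability T R) (X : T -> \bar R)
    (A : set T) : \bar R :=
  ((fine (Pr A))^-1%:E * \int[Pr]_(t in A) X t)%E.

Section lyapunov.
Context {R : realType} {d n : nat}.
Variables (f : 'I_n -> 'cV[R]_d -> R) (psi : 'cV[R]_d -> \bar R).
Variables (c : constants R) (xstar : 'cV[R]_d).

Definition gap (x : 'cV[R]_d) : \bar R :=
  (objective f psi x - objective f psi xstar)%E.

Definition calZ (st : state R d) : \bar R :=
  (Lmax c * (1 + eta_ c * sigma c) / (2 * eta_ c) * sqnorm (zk st - xstar))%:E.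

Definition calY (st : state R d) : \bar R :=
  ((theta1 c)^-1%:E * gap (yk st))%E.

Definition calW (q : R) (st : state R d) : \bar R :=
  ((theta2 c / (pw c * q * theta1 c))%:E * gap (wk st))%E.

Definition Psi (q : R) (st : state R d) : \bar R :=
  (calZ st + calY st + calW q st)%E.

End lyapunov.

(* Main.v *)
Require Import Defs.
From HB Require Import structures.
From mathcomp Require Import all_boot all_order all_algebra finmap.
From mathcomp Require Import all_classical all_reals all_analysis.
From mathcomp Require Import measurable_realfun ring lra.
Import Order.TTheory GRing.Theory Num.Theory.
Import numFieldNormedType.Exports.
Local Open Scope classical_set_scope.
Local Open Scope ring_scope.

(** Write [x, y, z, w] for the current points, [z', y'] for the new ones, and
    [P = f + psi].  The new point [z'] minimizes
      [psi u + <g, u> + L / (2 eta) |u - z|^2 + mu_f / 2 |u - x|^2],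
    which is strongly convex with modulus [L / eta + mu].  Comparing its values
    at [z'] and at [x*] bounds the new [Z] by the old one plus terms in
    [<g, x* - z'>] ([prox_subgradient]).  Since [y' - x = theta1 (z' - z)], the
    descent inequality of [f] at [y'] turns [<grad f x, z' - z>] into
    [(f y' - f x) / theta1], and Young's inequality trades the error
    [<g - grad f x, z' - z>] against the quadratic term that [eta = 1 / (3 theta1)]
    leaves available, at the cost of [|g - grad f x|^2 / (4 L theta1)].  As [y'] is
    a convex combination of [z'], [w] and [y], convexity of [psi] completes [f y']
    into [P y'] ([prox_step_bound]).

    On average [g] is [grad f x], and its variance is at most
    [2 L2 (f w - f x - <grad f x, w - x>)].  With [theta2 = L2 / (2 L)] this
    Bregman distance enters with the factor [theta2 / theta1], exactly the one
    with which it is gained when [z - x] is written through [x - w] and [x - y];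
    what remains is linear in [P y] and [P w] ([prox_step_mean]).  Averaging
    the coin flip as well gives the three-term recursion ([expected_Psi_step]);
    when [P y] or [P w] is infinite, so is its right-hand side.

    The proximal points exist because the optimality of [x*] provides an affine
    minorant of [psi] ([optimality_minorant]): the sublevel sets of the proximal
    objective are then closed, nonempty, and by strong convexity of vanishing
    diameter, hence form a Cauchy filter whose limit is the minimizer
    ([prox_minimizes]).

    The iterates are a recursion driven by independent draws from a finite set,
    so that the current state takes finitely many values and the draws of the
    next step can be averaged out on any event determined by it
    ([integral_run_next]).  This gives the conditional statement at once, and the
    decay of [E Psi] by induction ([integral_run_contraction]).

    For the complexity, [1 - q = min (theta1, theta2) / (3 theta2)] balances the
    decrease of [Y] and [W]: in each regime of the parameters all three
    contraction factors are at most [1 - 1 / (6 M)] with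
    [M = 1 / p + sqrt (L_f / mu) + sqrt (L2 / (mu p))], and
    [(1 - 1 / (6 M)) ^ k <= exp (- k / (6 M))], so the absolute constant is 6. *)

(** * Euclidean inner product and first-order inequalities *)

Section inner_product.
Context {R : realType} {d : nat}.
Implicit Types u v w : 'cV[R]_d.

Lemma dotC u v : dot u v = dot v u.
Proof. by apply: eq_bigr => i _; rewrite mulrC. Qed.

Lemma dotDl u v w : dot (u + v) w = dot u w + dot v w.
Proof. by rewrite -big_split; apply: eq_bigr => i _; rewrite mxE mulrDl. Qed.

Lemma dotDr u v w : dot w (u + v) = dot w u + dot w v.
Proof. by rewrite dotC dotDl !(dotC w). Qed.

Lemma dotZl (a : R) u w : dot (a *: u) w = a * dot u w.
Proof. by rewrite mulr_sumr; apply: eq_bigr => i _; rewrite mxE mulrA. Qed.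

Lemma dotZr (a : R) u w : dot w (a *: u) = a * dot w u.
Proof. by rewrite dotC dotZl dotC. Qed.

Lemma dotNl u w : dot (- u) w = - dot u w.
Proof. by rewrite -scaleN1r dotZl mulN1r. Qed.

Lemma dotNr u w : dot w (- u) = - dot w u.
Proof. by rewrite dotC dotNl dotC. Qed.

Lemma dot0r w : dot w 0 = 0.
Proof. by rewrite -(scale0r w) dotZr mul0r. Qed.

(** Expansion of inner products by bilinearity. *)
Definition dotE := (dotDl, dotDr, dotNl, dotNr, dotZl, dotZr).

Lemma sqnorm_ge0 u : 0 <= sqnorm u.
Proof. by apply: sumr_ge0 => i _; rewrite -expr2 sqr_ge0. Qed.

Lemma sqr_coord_le_sqnorm u i : u i 0 ^+ 2 <= sqnorm u.
Proof.
rewrite /sqnorm /dot (bigD1 i)//= -expr2 lerDl.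
by apply: sumr_ge0 => j _; rewrite -expr2 sqr_ge0.
Qed.

Lemma dot_suml (I : finType) (F : I -> 'cV[R]_d) w :
  dot (\sum_i F i) w = \sum_i dot (F i) w.
Proof.
elim/big_ind2: _ => [|a b a' b' <- <-|//]; last by rewrite dotDl.
by rewrite dotC dot0r.
Qed.

(** A form of Young's inequality: expand the square of [u + b *: v]. *)
Lemma dot_ge_young (b : R) u v : 0 < b ->
  - (b^-1 / 2 * sqnorm u + b / 2 * sqnorm v) <= dot u v.
Proof.
move=> b0; have := sqnorm_ge0 (u + b *: v).
rewrite /sqnorm !dotE (dotC v u) => h.
rewrite -subr_ge0.
have -> : dot u v - - (b^-1 / 2 * dot u u + b / 2 * dot v v) =
  b^-1 / 2 * (dot u u + b * dot u v + (b * dot u v + b * (b * dot v v))).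
  by field; rewrite gt_eqF.
by rewrite mulr_ge0// mulr_ge0// ?invr_ge0 ltW.
Qed.

End inner_product.

Section first_order.
Context {R : realType} {d : nat}.
Implicit Types (F : 'cV[R]_d -> R) (x y v : 'cV[R]_d).

Lemma dot_grad F x v : differentiable F x -> dot (grad F x) v = 'D_v F x.
Proof.
move=> dF; rewrite deriveE//.
have -> : v = \sum_(i < d) v i 0 *: delta_mx i 0.
  rewrite {1}(matrix_sum_delta v); apply: eq_bigr => i _.
  by rewrite big_ord_recl big_ord0 addr0.
rewrite linear_sum/= /dot; apply: eq_bigr => i _.
rewrite linearZ/= summxE (bigD1 i)//= big1 ?addr0; last first.
  by move=> j ji; rewrite !mxE eqxx andbT eq_sym (negbTE ji) mulr0.
by rewrite !mxE !eqxx mulr1 deriveE// mulrC.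
Qed.

(** First-order conditions are extracted from convexity on a segment by letting
    its parameter [t] tend to 0. *)
Lemma ler_affine_limit (a b e : R) :
  (forall t, 0 < t < 1 -> a <= b + e * t) -> a <= b.
Proof.
move=> h; rewrite leNgt; apply/negP => ba.
(* for this [t], the term [e * t] is less than the gap [a - b] *)
pose t : R := (a - b) / (2 * (`|e| + (a - b) + 1)).
have den : 0 < 2 * (`|e| + (a - b) + 1) :> R by have := normr_ge0 e; lra.
have t0 : 0 < t by rewrite divr_gt0// subr_gt0.
have t1 : t < 1 by rewrite ltr_pdivrMr// mul1r; have := normr_ge0 e; lra.
have := h t; rewrite t0 t1 => /(_ isT); rewrite leNgt => /negP; apply.
have : e * t <= `|e| * t by rewrite ler_wpM2r ?ler_norm// ltW.
have : `|e| * t < a - b.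
  rewrite /t mulrA ltr_pdivrMr//.
  have := normr_ge0 e; nra.
lra.
Qed.

(** A bound on the difference quotients that tends to [a] bounds the derivative. *)
Lemma derive_le_slope F x v (a e : R) : differentiable F x ->
  (forall t, 0 < t < 1 -> F (x + t *: v) - F x <= t * (a + e * t)) ->
  'D_v F x <= a.
Proof.
move=> dF h.
pose slope t := t^-1 *: ((F \o shift x) (t *: v) - F x).
have slope_cvg : slope @ 0^'+ --> 'D_v F x.
  have dFv : derivable F x v by apply: diff_derivable.
  exact: cvg_dnbhs_at_right dFv.
have bound_cvg : (a + e * t) @[t --> 0^'+] --> a.
  have : (a + e * t) @[t --> 0^'+] --> a + e * (0 : R).
    apply: (@cvg_at_right_filter _ _ (fun t => a + e * t)).
    by apply: cvgD; [exact: cvg_cst|apply: cvgM; [exact: cvg_cst|exact: cvg_id]].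
  by rewrite mulr0 addr0.
apply: (ler_cvg_to slope_cvg bound_cvg); near=> t.
have t0 : 0 < t by near: t; exact: nbhs_right_gt.
have t1 : t < 1 by near: t; exact: nbhs_right_lt.
rewrite /slope /= [t *: v + x]addrC /GRing.scale/=.
by rewrite [leLHS]mulrC ler_pdivrMr// [leRHS]mulrC h ?t0.
Unshelve. all: by end_near. Qed.

Lemma derive_ge_slope F x v (a e : R) : differentiable F x ->
  (forall t, 0 < t < 1 -> t * (a + e * t) <= F (x + t *: v) - F x) ->
  a <= 'D_v F x.
Proof.
move=> dF h; rewrite -[leRHS]opprK lerNr -deriveN; last exact/diff_derivable.
apply: (@derive_le_slope _ _ _ _ (- e)) => [|t t01].
  exact: differentiableN.
by have := h _ t01; rewrite !fctE; lra.
Qed.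

Lemma convex_functionP (G : 'cV[R]_d -> R) x y (t : R) :
  convex_function (E := 'cV[R]_d) setT G -> 0 <= t -> t <= 1 ->
  G (t *: x + (1 - t) *: y) <= t * G x + (1 - t) * G y.
Proof. by move=> cG t0 t1; apply: (cG (Itv01 t0 t1)); rewrite inE. Qed.

(** A function which is convex up to the quadratic [k / 2 * sqnorm] lies above
    its first-order expansion plus that quadratic; [k] may be negative. *)
Lemma convex_first_order (k : R) F x y : differentiable F x ->
  convex_function (E := 'cV[R]_d) setT (fun x => F x - k / 2 * sqnorm x) ->
  F x + dot (grad F x) (y - x) + k / 2 * sqnorm (y - x) <= F y.
Proof.
move=> dF cF; rewrite dot_grad// -lerBrDr -lerBrDl.
apply: (@derive_le_slope _ _ _ _ (k / 2 * sqnorm (y - x))) => // t t01.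
have t_ge0 : 0 <= t by lra.
have t_le1 : t <= 1 by lra.
have := convex_functionP _ y x _ cF t_ge0 t_le1.
have -> : t *: y + (1 - t) *: x = x + t *: (y - x).
  by rewrite scalerBl scale1r scalerBr addrCA addrA.
by rewrite /sqnorm !dotE (dotC y x); lra.
Qed.

Lemma convexN_first_order (k : R) F x y : differentiable F x ->
  convex_function (E := 'cV[R]_d) setT (fun x => k / 2 * sqnorm x - F x) ->
  F y <= F x + dot (grad F x) (y - x) + k / 2 * sqnorm (y - x).
Proof.
move=> dF cF; rewrite dot_grad// -lerBlDr -lerBlDl.
apply: (@derive_ge_slope _ _ _ _ (k / 2 * sqnorm (y - x))) => // t t01.
have t_ge0 : 0 <= t by lra.
have t_le1 : t <= 1 by lra.
have := convex_functionP _ y x _ cF t_ge0 t_le1.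
have -> : t *: y + (1 - t) *: x = x + t *: (y - x).
  by rewrite scalerBl scale1r scalerBr addrCA addrA.
by rewrite /sqnorm !dotE (dotC y x); lra.
Qed.

Lemma differentiable_favg n (f : 'I_n -> 'cV[R]_d -> R) x :
  (forall i, differentiable (f i) x) -> differentiable (favg f) x.
Proof.
move=> df; have -> : favg f = n%:R^-1 *: (\sum_(i < n) f i).
  by apply/funext => u; rewrite /favg fctE fct_sumE.
exact/differentiableZ/differentiable_sum.
Qed.

Lemma grad_favg n (f : 'I_n -> 'cV[R]_d -> R) x :
  (forall i, differentiable (f i) x) -> grad (favg f) x = averaged (Gmx f x).
Proof.
move=> df; apply/colP => j; rewrite !mxE.
have -> : favg f = n%:R^-1 *: (\sum_(i < n) f i).
  by apply/funext => u; rewrite /favg fctE fct_sumE.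
have dfi i : derivable (f i) x (delta_mx j 0) by exact/diff_derivable.
rewrite deriveZ ?derive_sum//; last exact: derivable_sum.
rewrite /GRing.scale/=; congr (_ * _); apply: eq_bigr => i _.
by rewrite !mxE mulr1.
Qed.

End first_order.

(** * The proximal operator *)

(** The set where an extended real function is finite; for a function avoiding
    [-oo] this is its effective domain. *)
Definition finite_dom {R : realType} {d : nat} (g : 'cV[R]_d -> \bar R) :
  set 'cV[R]_d := [set x | g x \is a fin_num].

(** The real value of the objective of [prox psi h v] at a point of finiteness. *)
Definition prox_cost {R : realType} {d : nat} (psi : 'cV[R]_d -> \bar R)
    (h : R) (v u : 'cV[R]_d) : R :=
  (2 * h)^-1 * sqnorm (v - u) + fine (psi u).

Section proximal.
Context {R : realType} {d : nat}.
Variables (psi : 'cV[R]_d -> \bar R) (m : R).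
Hypothesis psi_proper : proper_efun psi.
Hypothesis m_ge0 : 0 <= m.
Hypothesis psi_convex :
  convex_efun (fun x => psi x - (m / 2 * sqnorm x)%:E)%E.
Implicit Types u v x y z : 'cV[R]_d.

Local Notation dom := (finite_dom psi).

Lemma notin_finite_dom x : ~ dom x -> psi x = +oo%E.
Proof.
have := psi_proper.1 x; rewrite /finite_dom /= fin_numE.
by case: (psi x) => //= r _ /(_ isT).
Qed.

Lemma finite_domE x : dom x -> psi x = (fine (psi x))%:E.
Proof. by move=> dx; rewrite fineK. Qed.

Lemma finite_dom_le x (r : R) : (psi x <= r%:E)%E -> dom x.
Proof.
by move=> h; apply: contrapT => /notin_finite_dom e; rewrite e leye_eq in h.
Qed.

(** Strong convexity of modulus [m], as an inequality between real values. *)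
Lemma strong_convex_fine x y (t : R) : dom x -> dom y -> 0 <= t <= 1 ->
  dom (t *: x + (1 - t) *: y) /\
  fine (psi (t *: x + (1 - t) *: y)) <=
    t * fine (psi x) + (1 - t) * fine (psi y) -
    m / 2 * (t * (1 - t) * sqnorm (x - y)).
Proof.
move=> dx dy t01.
have h := psi_convex _ x y t01; cbv beta in h; move: h.
set p := fine (psi x); set q := fine (psi y).
rewrite [psi x](finite_domE _ dx) [psi y](finite_domE _ dy) -/p -/q.
rewrite leeBlDr// -!EFinB -!EFinM -!EFinD => h.
have dz := finite_dom_le _ _ h; split => //.
move: h; rewrite (finite_domE _ dz) lee_fin => h.
by apply: (le_trans h); rewrite le_eqVlt; apply/orP; left; apply/eqP;
  rewrite /sqnorm !dotE (dotC y x); field.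
Qed.

Lemma differentiable_sqnormB v u : differentiable (fun w => sqnorm (v - w) : R) u.
Proof.
pose c i : 'cV[R]_d -> R := cst (v i 0) - (fun N : 'cV[R]_d => N i 0).
have -> : (fun u => sqnorm (v - u)) = \sum_(i < d) (c i * c i).
  apply/funext => w; rewrite fct_sumE.
  by apply: eq_bigr => i _; rewrite /c !fctE !mxE.
apply: differentiable_sum => i.
have dc : differentiable (c i) u.
  by apply: differentiableB => //; exact: differentiable_coord.
exact: differentiableM.
Qed.

Lemma sub_coord_lt u u' (e : R) i : 0 < e -> sqnorm (u - u') < e ^+ 2 ->
  `|u i 0 - u' i 0| < e.
Proof.
move=> e0 h; have := le_lt_trans (sqr_coord_le_sqnorm _ i) h.
by rewrite !mxE -[X in X < _]real_normK ?num_real// ltr_pXn2r// nnegrE ltW.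
Qed.

Variables (h alpha : R) (beta : 'cV[R]_d).
Hypothesis h_gt0 : 0 < h.
Hypothesis psi_closed : closed_efun psi.
(* an affine minorant of [psi] makes the proximal objective coercive *)
Hypothesis psi_minorant :
  forall u, dom u -> alpha + dot beta u <= fine (psi u).

Local Notation phi := (prox_cost psi h).

(** The proximal objective is bounded below: minimize the sum of the quadratic
    and of the affine minorant. *)
Lemma prox_cost_bounded_below v u : dom u ->
  alpha + dot beta v - h / 2 * sqnorm beta <= phi v u.
Proof.
move=> du; apply: (@le_trans _ _ ((2 * h)^-1 * sqnorm (v - u) + (alpha + dot beta u))).
  have hi : 0 < h^-1 by rewrite invr_gt0.
  have := @dot_ge_young _ _ h^-1 beta (u - v) hi.
  rewrite invrK -subr_ge0 => H; rewrite -subr_ge0.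
  rewrite [leRHS](_ : _ = dot beta (u - v) -
    - (h / 2 * sqnorm beta + h^-1 / 2 * sqnorm (u - v)))//.
  rewrite /sqnorm !dotE (dotC u v); field.
  by rewrite gt_eqF.
by rewrite lerD2l psi_minorant.
Qed.

(** Strong convexity of the proximal objective, at midpoints; the part of the
    modulus coming from [psi] is not needed. *)
Lemma prox_cost_midpoint v x y : dom x -> dom y ->
  dom (2^-1 *: x + (1 - 2^-1) *: y) /\
  phi v (2^-1 *: x + (1 - 2^-1) *: y) <=
    (phi v x + phi v y) / 2 - (8 * h)^-1 * sqnorm (x - y).
Proof.
move=> dx dy; have t01 : 0 <= (2^-1 : R) <= 1 by lra.
have [dz Hz] := strong_convex_fine _ _ _ dx dy t01; split => //.
move: Hz.
have : 0 <= m / 2 * (2^-1 * (1 - 2^-1) * sqnorm (x - y)).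
  by rewrite mulr_ge0 ?mulr_ge0 ?sqnorm_ge0//; lra.
have -> : (8 * h)^-1 = (2 * h)^-1 / 4 by field; rewrite gt_eqF.
rewrite /prox_cost; set z := 2^-1 *: x + _.
have -> : sqnorm (v - z) =
    (sqnorm (v - x) + sqnorm (v - y)) / 2 - sqnorm (x - y) / 4.
  by rewrite /z /sqnorm !dotE (dotC x v) (dotC y v) (dotC y x); field.
by move: (fine _) (fine _) (fine _) (sqnorm _) (sqnorm _) (sqnorm _) => *; lra.
Qed.

(** The proximal problem has a solution, so that [prox] is one. *)
Lemma prox_minimizes v : (exists u, dom u) ->
  dom (prox psi h v) /\
  forall u, dom u -> phi v (prox psi h v) <= phi v u.
Proof.
move=> [u0 du0].
pose E : set R := [set phi v u | u in dom].
have E_lb : has_lbound E.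
  exists (alpha + dot beta v - h / 2 * sqnorm beta) => _ [w dw <-].
  exact: prox_cost_bounded_below.
have E_inf : has_inf E by split => //; exists (phi v u0); exists u0.
have inf_le w : dom w -> inf E <= phi v w.
  by move=> dw; apply: ge_inf => //; exists w.
(* the [e]-minimizers; their diameter vanishes with [e] *)
pose K (e : R) : set 'cV[R]_d := [set w | dom w /\ phi v w <= inf E + e].
have K_closed e : closed (K e).
  (* [K e] is the preimage of the closed epigraph under a continuous map *)
  have -> : K e = (fun w => (w, inf E + e - (2 * h)^-1 * sqnorm (v - w))) @^-1`
      [set xr : 'cV[R]_d * R | (psi xr.1 <= xr.2%:E)%E].
    apply/seteqP; split => w /=.
      by move=> [dw]; rewrite (finite_domE _ dw) lee_fin /prox_cost; lra.
    move=> H; have dw := finite_dom_le _ _ H; split => //.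
    by move: H; rewrite (finite_domE _ dw) lee_fin /prox_cost; lra.
  apply: preimage_closed => // w _.
  pose g w := inf E + e - (2 * h)^-1 * sqnorm (v - w).
  have g_cvg : {for w, continuous g}.
    apply: differentiable_continuous.
    have -> : g = cst (inf E + e) - (2 * h)^-1 *: (fun w => sqnorm (v - w)) by [].
    apply: differentiableB => //.
    exact/differentiableZ/differentiable_sqnormB.
  have id_cvg : x @[x --> w] --> w by exact: cvg_id.
  exact: (cvg_pair id_cvg g_cvg).
have K_diam e w w' : K e w -> K e w' -> sqnorm (w - w') <= 8 * h * e.
  move=> [dw Kw] [dw' Kw'].
  have [dz Hz] := prox_cost_midpoint v _ _ dw dw'; have := inf_le _ dz.
  by rewrite -ler_pdivrMl; [lra|rewrite mulr_gt0].
pose F := filter_from [set e : R | 0 < e] K.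
have FF : ProperFilter F.
  apply: filter_from_proper.
    apply: filter_from_filter; first by exists 1 => /=.
    move=> a b a0 b0; exists (Num.min a b); first by rewrite /= lt_min a0.
    move=> w [dw]; rewrite -lerBlDl le_min => /andP[wa wb].
    by split; split => //; lra.
  move=> e e0; have [_ [w dw <-] Hw] := inf_adherent e0 E_inf.
  by exists w; split => //; exact: ltW.
have F_cauchy : cauchy F.
  apply: cauchy_exP => e /= e0.
  (* [K r] has squared diameter at most [8 * h * r = e ^+ 2 / 2] *)
  pose r := e ^+ 2 / (16 * h).
  have r0 : 0 < r by rewrite divr_gt0 ?exprn_gt0// mulr_gt0.
  have [_ [w dw <-] Hw] := inf_adherent r0 E_inf.
  exists w; exists r => // w' Kw'; split => // i j; rewrite (ord1 j).
  apply: sub_coord_lt => //.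
  apply: (@le_lt_trans _ _ (8 * h * r)).
    by apply: K_diam => //; split => //; exact: ltW.
  rewrite (_ : 8 * h * r = e ^+ 2 / 2); last by rewrite /r; field; rewrite gt_eqF.
  have : 0 < e ^+ 2 by rewrite exprn_gt0.
  by lra.
have F_lim : F --> lim F by exact: cauchy_cvg.
have lim_K e : 0 < e -> K e (lim F).
  move=> e0; apply: (@closed_cvg _ _ F _ id (K e) (K_closed e)) => //.
  by exists e.
have dl : dom (lim F) by have [] := lim_K 1 ltr01.
have lim_min w : dom w -> phi v (lim F) <= phi v w.
  move=> dw; apply: (le_trans _ (inf_le _ dw)); apply/ler_addgt0Pl => e e0.
  by rewrite addrC; have [] := lim_K e e0.
have objE w : dom w ->
    (((2 * h)^-1 * sqnorm (v - w)%R)%:E + psi w = (phi v w)%:E)%E.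
  by move=> dw; rewrite (finite_domE _ dw) -EFinD.
rewrite /prox; case: xgetP => [p _ /= p_min|/(_ (lim F))/=]; last first.
  move=> notmin; exfalso; apply: notmin => w; rewrite objE//.
  have [dw|/notin_finite_dom ->] := pselect (dom w); last by rewrite addey// leey.
  by rewrite objE// lee_fin lim_min.
have dp : dom p.
  apply: contrapT => /notin_finite_dom e.
  by have := p_min u0; rewrite e addey// leye_eq objE.
by split => // w dw; have := p_min w; rewrite !objE// lee_fin.
Qed.

(** The optimality condition of the proximal step, in the form of a strongly
    convex subgradient inequality. *)
Lemma prox_subgradient v u : dom u ->
  let p := prox psi h v in
  dom p /\
  fine (psi p) + h^-1 * dot (v - p) (u - p) + m / 2 * sqnorm (u - p)
    <= fine (psi u).
Proof.
move=> du p; have dp : dom p by have [] := prox_minimizes v (ex_intro _ u du).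
split => //.
apply: (@ler_affine_limit _ _ _
  (m / 2 * sqnorm (u - p) + (2 * h)^-1 * sqnorm (u - p))) => t t01.
have t01' : 0 <= t <= 1 by lra.
have [dz Hz] := strong_convex_fine u p t du dp t01'.
(* compare the value at [p] with those on the segment from [p] to [u] *)
have [_ /(_ _ dz)] := prox_minimizes v (ex_intro _ u du).
rewrite -/p /prox_cost.
have -> : sqnorm (v - (t *: u + (1 - t) *: p)) =
    sqnorm (v - p) - 2 * t * dot (v - p) (u - p) + t ^+ 2 * sqnorm (u - p).
  by rewrite /sqnorm !dotE (dotC u v) (dotC p v) (dotC p u); ring.
have -> : h^-1 = 2 * (2 * h)^-1 by field; rewrite gt_eqF.
move: Hz; rewrite (_ : sqnorm (u - p) = sqnorm (p - u)); last first.
  by rewrite /sqnorm !dotE (dotC p u); ring.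
move: (fine _) (fine _) (fine _) (sqnorm _) (sqnorm _) (dot _ _) => *.
have t0 : 0 < t by lra.
rewrite -subr_ge0 -(pmulr_rge0 _ t0); nra.
Qed.

End proximal.

(** * One accelerated proximal step *)

(** The composite objective [F + psi], minimized at [xstar]: [F] is [l]-smooth and
    [psi] is [m]-strongly convex. *)
Section composite.
Context {R : realType} {d : nat}.
Variables (F : 'cV[R]_d -> R) (psi : 'cV[R]_d -> \bar R) (m l : R).
Variables (xstar : 'cV[R]_d).
Hypothesis psi_proper : proper_efun psi.
Hypothesis psi_closed : closed_efun psi.
Hypothesis m_ge0 : 0 <= m.
Hypothesis psi_convex :
  convex_efun (fun x => psi x - (m / 2 * sqnorm x)%:E)%E.
Hypothesis F_smooth : forall x y,
  F y <= F x + dot (grad F x) (y - x) + l / 2 * sqnorm (y - x).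
Hypothesis dom_xstar : finite_dom psi xstar.
Hypothesis xstar_min : forall u, finite_dom psi u ->
  F xstar + fine (psi xstar) <= F u + fine (psi u).
Implicit Types u v w x y z g : 'cV[R]_d.
Local Notation dom := (finite_dom psi).
Local Notation rpsi u := (fine (psi u)).

(** First-order optimality of [xstar]: the negated gradient of the smooth part is
    a subgradient of [psi] there. *)
Lemma optimality_minorant u : dom u ->
  rpsi xstar + dot (grad F xstar) xstar + dot (- grad F xstar) u <= rpsi u.
Proof.
move=> du.
rewrite (_ : _ + _ + _ = rpsi xstar - dot (grad F xstar) (u - xstar)); last first.
  by rewrite !dotE; ring.
apply: (@ler_affine_limit _ _ _ (l / 2 * sqnorm (u - xstar))) => t t01.
have t01' : 0 <= t <= 1 by lra.
(* compare the value at [xstar] with those on the segment to [u] *)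
have [dz Hz] := strong_convex_fine _ _ psi_proper psi_convex _ _ _ du dom_xstar t01'.
have := xstar_min _ dz; have := F_smooth xstar (t *: u + (1 - t) *: xstar).
rewrite (_ : t *: u + (1 - t) *: xstar - xstar = t *: (u - xstar)); last first.
  by apply/colP => i; rewrite !mxE; ring.
rewrite /sqnorm !dotZl !dotZr -/(sqnorm (u - xstar)).
have : 0 <= m / 2 * (t * (1 - t) * sqnorm (u - xstar)).
  rewrite !mulr_ge0 ?sqnorm_ge0//; lra.
move: Hz; move: (m / 2 * _) (F (_ + _)) (rpsi (_ + _)) => *.
have t0 : 0 < t by lra.
rewrite -subr_ge0 -(pmulr_rge0 _ t0); nra.
Qed.

(** Convexity of [psi] at three points, with [a < 1] so that the last two can be
    grouped. *)
Lemma convex_comb3_fine (a b : R) x y z : dom x -> dom y -> dom z ->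
  0 <= a -> a < 1 -> 0 <= b -> a + b <= 1 ->
  dom (a *: x + b *: y + (1 - a - b) *: z) /\
  rpsi (a *: x + b *: y + (1 - a - b) *: z) <=
    a * rpsi x + b * rpsi y + (1 - a - b) * rpsi z.
Proof.
move=> dx dy dz a0 a1 b0 ab.
have a1' : 1 - a != 0 by rewrite subr_eq0 eq_sym lt_eqF.
have convex_fine u v t : dom u -> dom v -> 0 <= t <= 1 ->
    dom (t *: u + (1 - t) *: v) /\
    rpsi (t *: u + (1 - t) *: v) <= t * rpsi u + (1 - t) * rpsi v.
  move=> du dv t01.
  have [dw Hw] := strong_convex_fine _ _ psi_proper psi_convex _ _ _ du dv t01.
  split => //; apply: (le_trans Hw); rewrite gerBl.
  by rewrite !mulr_ge0 ?sqnorm_ge0//; lra.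
pose t := b / (1 - a).
have t01 : 0 <= t <= 1.
  by rewrite divr_ge0//= ?ler_pdivrMr ?mul1r; lra.
have a01 : 0 <= a <= 1 by lra.
have [dw Hw] := convex_fine y z t dy dz t01.
have [dq Hq] := convex_fine x _ a dx dw a01.
have tb : (1 - a) * t = b by rewrite /t mulrC divfK.
have E : a *: x + b *: y + (1 - a - b) *: z =
    a *: x + (1 - a) *: (t *: y + (1 - t) *: z).
  by rewrite scalerDr !scalerA mulrBr mulr1 tb addrA.
rewrite E; split => //; apply: (le_trans Hq).
rewrite -addrA lerD2l.
have -> : b * rpsi y + (1 - a - b) * rpsi z =
    (1 - a) * (t * rpsi y + (1 - t) * rpsi z) by rewrite -tb; ring.
by rewrite ler_wpM2l//; lra.
Qed.

Variables (L mf th1 th2 : R).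
Hypothesis L_gt0 : 0 < L.
Hypothesis lL : l <= L.
Hypothesis mf_ge0 : 0 <= mf.
Hypothesis th1_gt0 : 0 < th1.
Hypothesis th1_lt1 : th1 < 1.
Hypothesis th2_ge0 : 0 <= th2.
Hypothesis th12 : th1 + th2 <= 1.

Let eta := (3 * th1)^-1.
Let a := 1 + eta * (mf / L).

(** One iteration of the method for an arbitrary gradient estimate [g]: the
    deterministic part of the Lyapunov estimate, in which [g] enters linearly
    and through its squared error. *)
Lemma prox_step_bound x y z w g : dom y -> dom w ->
  x = th1 *: z + th2 *: w + (1 - th1 - th2) *: y ->
  let z' := prox psi (eta / (a * L))
    (a^-1 *: ((eta * (mf / L)) *: x + z - (eta / L) *: g)) in
  let y' := x + th1 *: (z' - z) in
  [/\ dom z', dom y' &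
  L * (1 + eta * ((mf + m) / L)) / (2 * eta) * sqnorm (z' - xstar)
    + th1^-1 * (F y' + rpsi y')
  <= rpsi xstar + L / (2 * eta) * sqnorm (z - xstar)
     + mf / 2 * sqnorm (xstar - x) + dot g (xstar - z) + th1^-1 * F x
     + (4 * L * th1)^-1 * sqnorm (g - grad F x)
     + th2 / th1 * rpsi w + (1 - th1 - th2) / th1 * rpsi y].
Proof.
move=> dy dw xE; set v := _ *: (_ - _) => z' y'.
have L0 : L != 0 by rewrite gt_eqF.
have th0 : th1 != 0 by rewrite gt_eqF.
have eta_gt0 : 0 < eta by rewrite invr_gt0 mulr_gt0.
have a_gt0 : 0 < a.
  by rewrite ltr_pwDl// mulr_ge0 ?divr_ge0// ltW.
have h_gt0 : 0 < eta / (a * L) by rewrite divr_gt0 ?mulr_gt0.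
have [dz'] := prox_subgradient _ _ psi_proper m_ge0 psi_convex _ _ _ h_gt0
  psi_closed optimality_minorant v _ dom_xstar.
rewrite -/z' => Hz'.
have y'E : y' = th1 *: z' + th2 *: w + (1 - th1 - th2) *: y.
  rewrite /y' {1}xE scalerBr; apply/colP => i; rewrite !mxE; ring.
have [dy' Hy'] := convex_comb3_fine _ _ _ _ _ dz' dw dy
  (ltW th1_gt0) th1_lt1 th2_ge0 th12.
rewrite -y'E in dy' Hy'; split => //.
(* the proximal step size and centre are chosen so that the scaled residual is
   minus the gradient of the quadratic model [<g, u> + L / (2 eta) |u - z|^2 +
   mf / 2 |u - x|^2] at [z'] *)
have hv : (eta / (a * L))^-1 * dot (v - z') (xstar - z') =
    dot (mf *: (x - z') + (3 * L * th1) *: (z - z') - g) (xstar - z').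
  rewrite -dotZl; congr (dot _ _); rewrite /v.
  rewrite scalerBr scalerA.
  have -> : (eta / (a * L))^-1 / a = 3 * L * th1.
    by rewrite /eta; field; rewrite th0 L0 gt_eqF.
  have -> : (eta / (a * L))^-1 = 3 * L * th1 + mf.
    by rewrite /a /eta; field; rewrite th0 L0 gt_eqF// ltr_wpDr// !mulr_gt0.
  by apply/colP => i; rewrite !mxE /eta; field; rewrite th0 L0.
rewrite hv in Hz'.
have Hsm := F_smooth x y'.
have y'x : y' - x = th1 *: (z' - z) by rewrite /y' addrAC subrr add0r.
rewrite y'x in Hsm.
(* with this constant, Young's inequality uses [L * th1] of the coefficient
   [3 / 2 * L * th1] of the squared norm of [z' - z], and the descent inequality
   uses at most the remaining [L * th1 / 2] *)
have b_gt0 : 0 < 2 * L * th1 by rewrite !mulr_gt0.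
have Hyo := dot_ge_young _ (g - grad F x) (z' - z) b_gt0.
have th1i : 0 < th1^-1 by rewrite invr_gt0.
have H2 : th1^-1 * F y' <= th1^-1 * F x + dot (grad F x) (z' - z) +
    l * th1 / 2 * sqnorm (z' - z).
  rewrite -(ler_pM2l th1_gt0); apply: (le_trans _ (le_trans Hsm _)).
    by rewrite mulrA divff// mul1r.
  rewrite /sqnorm !dotZl !dotZr le_eqVlt; apply/orP; left; apply/eqP.
  by field.
have H3 : th1^-1 * rpsi y' <=
    rpsi z' + th2 / th1 * rpsi w + (1 - th1 - th2) / th1 * rpsi y.
  rewrite -(ler_pM2l th1_gt0); apply: (le_trans _ (le_trans Hy' _)).
    by rewrite mulrA divff// mul1r.
  by rewrite le_eqVlt; apply/orP; left; apply/eqP; field.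
have H5 : l * th1 * sqnorm (z' - z) <= L * th1 * sqnorm (z' - z).
  by rewrite ler_wpM2r ?sqnorm_ge0// ler_wpM2r// ltW.
have H6 : 0 <= mf * sqnorm (x - z') by rewrite mulr_ge0 ?sqnorm_ge0.
have -> : L / (2 * eta) = 3 * L * th1 / 2 by rewrite /eta; field.
have -> : L * (1 + eta * ((mf + m) / L)) / (2 * eta) =
    3 * L * th1 / 2 + (mf + m) / 2 by rewrite /eta; field; rewrite th0 L0.
have -> : (4 * L * th1)^-1 = (2 * L * th1)^-1 / 2 by field; rewrite th0 L0.
have Hd : dot (g - grad F x) (z' - z) =
    dot g (z' - z) - dot (grad F x) (z' - z) by rewrite dotDl dotNl.
rewrite Hd in Hyo.
move: Hz' H2 H3 Hyo H5 H6.
(* everything is expressed in [xstar - z'], [z' - z] and [x - z'] *)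
have -> : z' - xstar = - (xstar - z') by rewrite opprB.
have -> : z - z' = - (z' - z) by rewrite opprB.
have -> : z - xstar = - ((xstar - z') + (z' - z)).
  by apply/colP => i; rewrite !mxE; ring.
have -> : xstar - x = (xstar - z') - (x - z').
  by apply/colP => i; rewrite !mxE; ring.
have -> : xstar - z = (xstar - z') + (z' - z).
  by apply/colP => i; rewrite !mxE; ring.
move: (xstar - z') (z' - z) (x - z') (sqnorm (g - _)) => q e r G.
rewrite /sqnorm !dotE (dotC e q) (dotC r q).
rewrite [th1^-1 * (_ + _)]mulrDr.
move: ((2 * L * th1)^-1) (th1^-1 * rpsi y') (th1^-1 * F y') => A B C.
lra.
Qed.

Hypothesis F_convex : forall x y,
  F x + dot (grad F x) (y - x) + mf / 2 * sqnorm (y - x) <= F y.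

Local Notation P u := (F u + rpsi u).

(** The Lyapunov estimate averaged over an unbiased gradient estimate [g] whose
    variance is bounded by the Bregman distance between [w] and [x]. *)
Lemma prox_step_mean (I : finType) (wt : I -> R) (g z' y' : I -> 'cV[R]_d)
    (l2 : R) x y z w :
  (forall i, 0 <= wt i) -> \sum_i wt i = 1 ->
  \sum_i wt i *: g i = grad F x ->
  \sum_i wt i * sqnorm (g i - grad F x) <=
    2 * l2 * (F w - F x - dot (grad F x) (w - x)) ->
  th2 = l2 / (2 * L) -> dom y -> dom w ->
  x = th1 *: z + th2 *: w + (1 - th1 - th2) *: y ->
  (forall i, z' i = prox psi (eta / (a * L))
    (a^-1 *: ((eta * (mf / L)) *: x + z - (eta / L) *: g i))) ->
  (forall i, y' i = x + th1 *: (z' i - z)) ->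
  \sum_i wt i *
    (L * (1 + eta * ((mf + m) / L)) / (2 * eta) * sqnorm (z' i - xstar)
     + th1^-1 * (P (y' i) - P xstar))
  <= L / (2 * eta) * sqnorm (z - xstar)
     + (1 - th1 - th2) / th1 * (P y - P xstar)
     + th2 / th1 * (P w - P xstar).
Proof.
move=> wt_ge0 wt1 g_mean g_var th2E dy dw xE z'E y'E.
have th0 : th1 != 0 by rewrite gt_eqF.
pose K := rpsi xstar + L / (2 * eta) * sqnorm (z - xstar)
  + mf / 2 * sqnorm (xstar - x) + th1^-1 * F x
  + th2 / th1 * rpsi w + (1 - th1 - th2) / th1 * rpsi y - th1^-1 * P xstar.
pose V i := sqnorm (g i - grad F x).
pose k := (4 * L * th1)^-1.
apply: (@le_trans _ _
    (\sum_i wt i * (K + dot (g i) (xstar - z) + k * V i))).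
  apply: ler_sum => i _; apply: ler_wpM2l => //.
  have [_ _] := prox_step_bound x y z w (g i) dy dw xE.
  by rewrite -z'E -y'E /K /k /V; lra.
have -> : \sum_i wt i * (K + dot (g i) (xstar - z) + k * V i) =
    K + dot (grad F x) (xstar - z) + k * \sum_i wt i * V i.
  rewrite -g_mean dot_suml mulr_sumr -[X in X + _ + _](mul1r K) -wt1 mulr_suml.
  by rewrite -!big_split; apply: eq_bigr => i _ /=; rewrite dotZl; ring.
have k0 : 0 <= k by rewrite invr_ge0 !mulr_ge0// ltW.
have := ler_wpM2l k0 g_var; rewrite -/V.
(* the value of [th2] turns the variance bound into the Bregman distance that
   the linear terms absorb *)
have -> : k * (2 * l2 * (F w - F x - dot (grad F x) (w - x))) =
    th2 / th1 * (F w - F x - dot (grad F x) (w - x)).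
  by rewrite /k th2E; field; rewrite th0 gt_eqF.
(* [th1 *: (x - z) = th2 *: (w - x) + (1 - th1 - th2) *: (y - x)] *)
have -> : dot (grad F x) (xstar - z) = dot (grad F x) (xstar - x) +
    th2 / th1 * dot (grad F x) (w - x) +
    (1 - th1 - th2) / th1 * dot (grad F x) (y - x).
  rewrite -!dotZr -!dotDr; congr (dot _ _); apply/colP => i.
  have := congr1 (fun u => u i 0) xE; rewrite !mxE => xiE.
  apply: (mulfI th0); rewrite !mulrDr !mulrA ![th1 * _ / th1]mulrAC divff// !mul1r.
  by lra.
have c3 : 0 <= (1 - th1 - th2) / th1.
  by apply: divr_ge0; [rewrite -addrA -opprD subr_ge0|exact: ltW].
have : (1 - th1 - th2) / th1 * (F x + dot (grad F x) (y - x)) <=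
    (1 - th1 - th2) / th1 * F y.
  apply: ler_wpM2l => //; apply: le_trans (F_convex x y).
  by rewrite lerDl mulr_ge0 ?sqnorm_ge0 ?divr_ge0.
have := F_convex x xstar; rewrite /K.
have -> : (1 - th1 - th2) / th1 = th1^-1 - 1 - th2 / th1.
  by rewrite !mulrBl mul1r divff.
move: (th2 / th1) (th1^-1) => c2 c1; lra.
Qed.

End composite.

(** * Step sizes and contraction rates *)

Section parameters.
Context {R : realType}.
Variable c : constants R.
Hypothesis p01 : 0 < pw c <= 1.
Hypothesis Lf_gt0 : 0 < Lf c.
Hypothesis mu_gt0 : 0 < mu c.
Hypothesis L2_gt0 : 0 < L2 c.

Let p_gt0 : 0 < pw c. Proof. by case/andP: p01. Qed.
Let p_le1 : pw c <= 1. Proof. by case/andP: p01. Qed.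
Let p_neq0 : pw c != 0. Proof. by rewrite gt_eqF. Qed.
Let Lf_neq0 : Lf c != 0. Proof. by rewrite gt_eqF. Qed.
Let L2_neq0 : L2 c != 0. Proof. by rewrite gt_eqF. Qed.

Lemma L2_le_Lmax : L2 c <= Lmax c. Proof. by rewrite le_max lexx. Qed.
Lemma Lf_le_Lmax : Lf c <= Lmax c. Proof. by rewrite le_max lexx orbT. Qed.
Lemma Lmax_gt0 : 0 < Lmax c. Proof. by rewrite lt_max L2_gt0. Qed.
Let Lmax_neq0 : Lmax c != 0. Proof. by rewrite gt_eqF ?Lmax_gt0. Qed.

Lemma theta2_gt0 : 0 < theta2 c.
Proof. by rewrite divr_gt0// mulr_gt0// Lmax_gt0. Qed.

Lemma theta2_le_half : theta2 c <= 1 / 2.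
Proof.
rewrite /theta2 ler_pdivrMr ?mulr_gt0 ?Lmax_gt0//.
by have := L2_le_Lmax; lra.
Qed.

Lemma theta1_gt0 : 0 < theta1 c.
Proof.
rewrite /theta1; case: ifP => _; rewrite lt_min ?theta2_gt0 ?andbT.
  by rewrite mulr_gt0 ?theta2_gt0// sqrtr_gt0 divr_gt0// mulr_gt0.
by rewrite sqrtr_gt0 !divr_gt0.
Qed.

Lemma theta1_le_half : theta1 c <= 1 / 2.
Proof.
rewrite /theta1; case: ifP => _; rewrite ge_min.
  by rewrite theta2_le_half orbT.
by apply/orP; right; move: p_le1; lra.
Qed.

Lemma eta_gt0 : 0 < eta_ c.
Proof. by rewrite invr_gt0 mulr_gt0// theta1_gt0. Qed.

(** The reciprocal of the condition number in the complexity bound; up to a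
    constant, it bounds from below all the contraction rates. *)
Definition rate : R :=
  ((pw c)^-1 + Num.sqrt (Lf c / mu c) + Num.sqrt (L2 c / (mu c * pw c)))^-1.

(* the reciprocals of the two square roots in [rate] *)
Let s : R := Num.sqrt (mu c / Lf c).
Let b : R := Num.sqrt (mu c * pw c / L2 c).

Let s_gt0 : 0 < s. Proof. by rewrite sqrtr_gt0 divr_gt0. Qed.
Let b_gt0 : 0 < b. Proof. by rewrite sqrtr_gt0 divr_gt0// mulr_gt0. Qed.

Let sV : Num.sqrt (Lf c / mu c) = s^-1.
Proof. by rewrite /s -sqrtrV ?invf_div// ltW// divr_gt0. Qed.

Let bV : Num.sqrt (L2 c / (mu c * pw c)) = b^-1.
Proof. by rewrite /b -sqrtrV ?invf_div// ltW// divr_gt0// mulr_gt0. Qed.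

Let s_sqr : s ^+ 2 = mu c / Lf c.
Proof. by rewrite sqr_sqrtr// ltW// divr_gt0. Qed.

Let b_sqr : b ^+ 2 = mu c * pw c / L2 c.
Proof. by rewrite sqr_sqrtr// ltW// divr_gt0// mulr_gt0. Qed.

Let bp : Num.sqrt (mu c / (L2 c * pw c)) = b / pw c.
Proof.
have -> : mu c / (L2 c * pw c) = (b / pw c) ^+ 2.
  by rewrite exprMn b_sqr; field; rewrite p_neq0 L2_neq0.
by rewrite sqrtr_sqr ger0_norm// ltW// divr_gt0.
Qed.

Let inv_le (M x : R) : 0 < x -> x^-1 <= M -> M^-1 <= x.
Proof.
move=> x0 xM; rewrite -[leRHS]invrK lef_pV2// posrE ?invr_gt0//.
by apply: lt_le_trans xM; rewrite invr_gt0.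
Qed.

Lemma rate_gt0 : 0 < rate.
Proof. by rewrite /rate sV bV invr_gt0 !addr_gt0// invr_gt0. Qed.

Lemma rate_le_pw : rate <= pw c.
Proof.
rewrite /rate sV bV; apply: inv_le => //.
by rewrite -addrA lerDl addr_ge0// invr_ge0 ltW.
Qed.

Let rate_le_s : rate <= s.
Proof.
rewrite /rate sV bV; apply: inv_le => //.
by rewrite addrAC lerDr addr_ge0// invr_ge0 ltW.
Qed.

Let rate_le_b : rate <= b.
Proof.
rewrite /rate sV bV; apply: inv_le => //.
by rewrite lerDr addr_ge0// invr_ge0 ltW.
Qed.

Lemma rate_le1 : rate <= 1.
Proof. exact: le_trans rate_le_pw p_le1. Qed.

(** The two regimes in the choice of [theta1]: in the first one the variance
    constant dominates, in the second one the smoothness constant. *)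
Variant theta1_cases : R -> Prop :=
| Theta1Variance of pw c / 2 <= theta2 c :
    theta1_cases (Num.min (b / pw c * theta2 c) (theta2 c))
| Theta1Smooth of Lmax c = Lf c & theta2 c <= pw c / 2 :
    theta1_cases (Num.min s (pw c / 2)).

Lemma theta1P : theta1_cases (theta1 c).
Proof.
rewrite /theta1 bp -/s; case: ifPn => [LfL2|]; last rewrite -ltNge => L2Lf.
  apply: Theta1Variance.
  rewrite /theta2 ler_pdivlMr ?mulr_gt0 ?Lmax_gt0//.
  rewrite (_ : pw c / 2 * _ = Lmax c * pw c); last by field.
  rewrite -ler_pdivlMr// /Lmax ge_max LfL2 andbT ler_pdivlMr//.
  by rewrite ler_piMr// ltW.
have Lle : Lmax c = Lf c.
  apply/max_idPr/ltW/(le_lt_trans _ L2Lf).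
  by rewrite ler_pdivlMr// ler_piMr// ltW.
apply: Theta1Smooth => //.
rewrite /theta2 Lle ler_pdivrMr ?mulr_gt0//.
rewrite (_ : pw c / 2 * _ = Lf c * pw c); last by field.
by rewrite -ler_pdivrMr// ltW.
Qed.

Lemma rate_le_theta1 : rate / 2 <= theta1 c.
Proof.
have := rate_le_pw; have := rate_le_b; have := rate_le_s.
case: theta1P => [pt|Lmaxf tp] rs rb rp; rewrite le_min; apply/andP; split;
  try by move: s_gt0; lra.
apply: (@le_trans _ _ (b / 2)); first by lra.
have -> : b / 2 = b / pw c * (pw c / 2) by field.
by rewrite ler_wpM2l// ltW// divr_gt0.
Qed.

(** A lower bound on [eta * sigma = mu / (3 * theta1 * Lmax)], for [contraction_z]. *)
Lemma theta1_rate_le_mu : theta1 c * Lmax c * rate <= mu c.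
Proof.
have r0 := ltW rate_gt0; have L0 := ltW Lmax_gt0.
move: (ltW theta1_gt0); case: theta1P => [pt|Lmaxf tp] t0.
  apply: (@le_trans _ _ (b / pw c * theta2 c * Lmax c * b)).
    apply: ler_pM; rewrite ?rate_le_b//.
      exact: mulr_ge0.
    by rewrite ler_wpM2r// ge_min lexx.
  have -> : b / pw c * theta2 c * Lmax c * b = b ^+ 2 * L2 c / (2 * pw c).
    by rewrite /theta2; field; rewrite p_neq0 Lmax_neq0.
  rewrite b_sqr (_ : _ / (2 * pw c) = mu c / 2).
    by move: mu_gt0; lra.
  by field; rewrite p_neq0 L2_neq0.
rewrite Lmaxf; apply: (@le_trans _ _ (s * Lf c * s)).
  apply: ler_pM; rewrite ?rate_le_s//.
    by rewrite mulr_ge0// ltW.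
  by rewrite ler_wpM2r ?(ltW Lf_gt0)// ge_min lexx.
by rewrite mulrAC -expr2 s_sqr divfK.
Qed.

(** The case of [contraction_w] where [theta1] is the smaller of the two
    parameters; the inequality holds in general. *)
Lemma theta2_rate_le : theta2 c * rate <= pw c * theta1 c.
Proof.
have r0 := ltW rate_gt0; have t20 := theta2_gt0; have rp := rate_le_pw.
case: theta1P => [pt|Lmaxf tp]; rewrite /Num.min; case: ifP => _.
- rewrite (_ : pw c * _ = theta2 c * b); last by field.
  by rewrite ler_wpM2l ?rate_le_b// ltW.
- by rewrite mulrC ler_wpM2r// ltW.
- rewrite ler_pM ?rate_le_s//; first exact: ltW.
  by apply: (le_trans tp); move: p_gt0; lra.
- by rewrite mulrC ler_pM// ltW.
Qed.

Lemma eta_sigma_ge : rate / 3 <= eta_ c * sigma c.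
Proof.
have L0 := Lmax_gt0; have t0 := theta1_gt0.
have -> : eta_ c * sigma c = mu c / (3 * theta1 c * Lmax c).
  by rewrite /eta_ /sigma; field; rewrite !gt_eqF.
rewrite ler_pdivlMr ?mulr_gt0//.
by have := theta1_rate_le_mu; lra.
Qed.

(** The parameter [q] of the Lyapunov function.  With [1 - q] proportional to
    [theta1 / theta2], at most half of the decrease [theta1] of the [y]-part is
    spent on the [w]-part; the minimum keeps [q] at least 2/3. *)
Definition balance : R := 1 - Num.min (theta1 c) (theta2 c) / (3 * theta2 c).

Lemma balance_bounds : 2 / 3 <= balance < 1.
Proof.
have t10 := theta1_gt0; have t20 := theta2_gt0.
have d0 : 0 < 3 * theta2 c by rewrite mulr_gt0.
apply/andP; split.
  have : Num.min (theta1 c) (theta2 c) / (3 * theta2 c) <= 1 / 3.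
    rewrite ler_pdivrMr//.
    by rewrite (_ : 1 / 3 * _ = theta2 c) ?ge_min ?lexx ?orbT//; field.
  by rewrite /balance; lra.
by rewrite /balance ltrBlDr ltrDl divr_gt0// lt_min t10.
Qed.

Lemma contraction_z : (1 + eta_ c * sigma c)^-1 <= 1 - rate / 6.
Proof.
have := eta_sigma_ge; have := rate_gt0; have := rate_le1.
move: (eta_ c * sigma c) rate => e r r1 r0 re.
have e0 : 0 <= e by lra.
rewrite -[leLHS]mul1r ler_pdivrMr; last by lra.
have h1 : 0 <= (1 - r / 6) * (e - r / 3) by rewrite mulr_ge0; lra.
have h2 : r * r <= r by rewrite ler_piMr// ltW.
by lra.
Qed.

Lemma contraction_y :
  1 - (theta1 c + theta2 c - theta2 c / balance) <= 1 - rate / 6.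
Proof.
have := rate_le_theta1; have := rate_gt0.
have t10 := theta1_gt0; have t20 := theta2_gt0.
have /andP[q23 q1] := balance_bounds.
suff : theta2 c / balance - theta2 c <= theta1 c / 2 by lra.
have q0 : balance != 0 by rewrite gt_eqF//; lra.
have -> : theta2 c / balance - theta2 c = theta2 c * (1 - balance) / balance.
  by field.
rewrite ler_pdivrMr; last by lra.
have -> : theta2 c * (1 - balance) = Num.min (theta1 c) (theta2 c) / 3.
  by rewrite /balance opprB addrC subrK; field; rewrite gt_eqF.
have : Num.min (theta1 c) (theta2 c) <= theta1 c by rewrite ge_min lexx.
by move: q23; nra.
Qed.

Lemma contraction_w : 1 - pw c * (1 - balance) <= 1 - rate / 6.
Proof.
have t20 := theta2_gt0; have r0 := rate_gt0.
rewrite lerD2l lerN2 /balance opprB addrC subrK.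
have : rate * theta2 c <= pw c * Num.min (theta1 c) (theta2 c).
  rewrite /Num.min; case: ifP => _; first by rewrite mulrC theta2_rate_le.
  by rewrite ler_wpM2r ?rate_le_pw// ltW.
have d0 : 0 < 3 * theta2 c by rewrite mulr_gt0.
move=> h; rewrite mulrA ler_pdivlMr//.
by apply: le_trans h; nra.
Qed.

Lemma rate_complexity (eps : R) (k : nat) : 0 < eps < 1 ->
  6 * rate^-1 * ln (eps^-1) <= k%:R -> (1 - rate / 6) ^+ k <= eps.
Proof.
move=> /andP[e0 e1] hk; have r0 := rate_gt0; have r1 := rate_le1.
apply: (@le_trans _ _ (expR (- (rate / 6)) ^+ k)).
  apply: lerXn2r; rewrite ?nnegrE ?expR_ge0//; first by lra.
  exact: expR_ge1Dx.
rewrite -expRM_natl -ler_ln ?posrE ?expR_gt0// expRK.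
move: hk; rewrite lnV ?posrE//.
rewrite (_ : 6 * rate^-1 * - ln eps = - ln eps / (rate / 6)).
  rewrite ler_pdivrMr ?divr_gt0//; lra.
by field; rewrite gt_eqF.
Qed.

End parameters.

(** * Random recursions with finitely many outcomes *)

Section finite_range.
Context {R : realType} {dsp : measure_display} {T : measurableType dsp}.
Context {I : finType} (Y : T -> I).
Hypothesis Y_measurable : forall i, measurable (Y @^-1` [set i]).

Lemma measurable_preimage_finite (A : set I) : measurable (Y @^-1` A).
Proof.
have -> : Y @^-1` A = \bigcup_(i in A) (Y @^-1` [set i]).
  apply/seteqP; split => [t At|t [i Ai /= ->]//].
  by exists (Y t).
exact: fin_bigcup_measurable.
Qed.

Lemma measurable_fun_finite_range (g : I -> \bar R) (D : set T) :
  measurable_fun D ((fun t => g (Y t)) : T -> \bar R).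
Proof.
move=> mD B mB; apply: measurableI => //.
exact: (measurable_preimage_finite (g @^-1` B)).
Qed.

Lemma ge0_integral_finite_range (mu : {measure set T -> \bar R})
    (g : I -> \bar R) (A : set T) :
  (forall i, 0 <= g i)%E -> measurable A ->
  (\int[mu]_(t in A) g (Y t) = \sum_i g i * mu (A `&` Y @^-1` [set i]))%E.
Proof.
move=> g0 mA.
have mF i : measurable (A `&` Y @^-1` [set i]) by exact: measurableI.
have AE : A = \big[setU/set0]_(i <- enum I) (A `&` Y @^-1` [set i]).
  rewrite -bigcup_seq; apply/seteqP; split => [t At|t [i _ []//]].
  by exists (Y t) => //=; rewrite mem_enum.
rewrite {1}AE ge0_integral_bigsetU//; last 3 first.
- exact: enum_uniq.
- by move=> i j _ _ [t [[_ /= <-] [_ /= <-]]].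
- exact: measurable_fun_finite_range.
rewrite big_enum; apply: eq_bigr => i _.
rewrite (eq_integral (cst (g i))); first exact: integral_cst.
by move=> t; rewrite inE => -[_ /= ->].
Qed.

End finite_range.

(** A random recursion [run] driven by a sequence [xi] of independent,
    identically distributed variables with values in a finite type. *)
Section random_iteration.
Context {R : realType} {dsp : measure_display} {T : measurableType dsp}.
Context (Pr : probability T R) {X : finType} {St : Type}.
Variables (xi : nat -> T -> X) (law : X -> R) (next : St -> X -> St) (s0 : St).
Hypothesis law_ge0 : forall x, 0 <= law x.
Hypothesis xi_measurable : forall k x, measurable (xi k @^-1` [set x]).
(* independence of [xi k] from the past, with [law] as its distribution *)
Hypothesis xi_independent : forall k (a : nat -> X),
  Pr [set t | forall j, (j < k.+1)%N -> xi j t = a j] =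
  ((law (a k))%:E * Pr [set t | forall j, (j < k)%N -> xi j t = a j])%E.

Fixpoint run (k : nat) (t : T) : St :=
  if k is k'.+1 then next (run k' t) (xi k' t) else s0.

(** The outcomes drawn before step [k]. *)
Definition history (k : nat) (t : T) : k.-tuple X := [tuple xi j t | j < k].

(** The transition operator of the recursion: the mean of [G] over the successors
    of [s]. *)
Definition expected_next (G : St -> \bar R) (s : St) : \bar R :=
  (\sum_x (law x)%:E * G (next s x))%E.

(** The default value of [nth] is irrelevant below [k]; at [k] it stands for the
    next outcome, see [history_independent]. *)
Lemma history_eqP k t (a : k.-tuple X) x :
  history k t = a <-> forall j, (j < k)%N -> xi j t = nth x a j.
Proof.
split=> [<- j jk|h].
  by rewrite (nth_map (Ordinal jk)) ?size_enum_ord// nth_enum_ord.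
apply: eq_from_tnth => j; rewrite tnth_mktuple (tnth_nth x).
exact: h.
Qed.

Lemma run_history k t : run k t = foldl next s0 (history k t).
Proof.
elim: k => [|k IH]; first by rewrite (tuple0 (history 0 t)).
rewrite [run _ _]/= IH -foldl_rcons; congr (foldl _ _ _).
apply: (@eq_from_nth _ (xi 0 t)); first by rewrite size_rcons !size_tuple.
move=> j; rewrite size_rcons size_tuple => jk.
rewrite nth_rcons size_tuple.
have e1 := (history_eqP _ t (history k.+1 t) (xi 0 t)).1 erefl.
have e2 := (history_eqP _ t (history k t) (xi 0 t)).1 erefl.
rewrite -e1//; case: (ltngtP j k) jk => [jk _|kj|->//]; first by rewrite -e2.
by rewrite ltnS leqNgt kj.
Qed.

Lemma measurable_history k (a : k.-tuple X) : measurable (history k @^-1` [set a]).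
Proof.
have -> : history k @^-1` [set a] =
    \bigcap_(j in [set: 'I_k]) (xi j @^-1` [set tnth a j]).
  apply/seteqP; split => [t /= <- j _ /=|t h /=].
    by rewrite tnth_mktuple.
  by apply: eq_from_tnth => j; rewrite tnth_mktuple h.
exact: fin_bigcap_measurable.
Qed.

Lemma history_independent k (a : k.-tuple X) x :
  Pr ((history k @^-1` [set a]) `&` (xi k @^-1` [set x])) =
  ((law x)%:E * Pr (history k @^-1` [set a]))%E.
Proof.
have := xi_independent k (nth x a); rewrite nth_default ?size_tuple// => h.
transitivity (Pr [set t | forall j, (j < k.+1)%N -> xi j t = nth x a j]).
  congr (Pr _); apply/seteqP; split => [t [/= ta tx] j|t h' /=].
    rewrite ltnS leq_eqVlt => /orP[/eqP ->|jk].
      by rewrite nth_default ?size_tuple.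
    exact: (history_eqP _ _ _ _).1.
  split; last by rewrite h'// nth_default ?size_tuple.
  by apply/(history_eqP _ _ _ x) => j jk; apply: h'; exact: ltnW.
rewrite h; congr (_ * Pr _)%E; apply/seteqP; split => t /=.
  by move=> /history_eqP.
by move=> ta; exact: (history_eqP _ _ _ _).1.
Qed.

Lemma measurable_run k (G : St -> \bar R) D :
  measurable_fun D ((fun t => G (run k t)) : T -> \bar R).
Proof.
pose g (a : k.-tuple X) := G (foldl next s0 a).
have -> : (fun t => G (run k t)) = (fun t => g (history k t)).
  by apply/funext => t; rewrite run_history.
exact/measurable_fun_finite_range/measurable_history.
Qed.

Lemma measurable_run_preimage k (U : set St) : measurable (run k @^-1` U).
Proof.
have -> : run k @^-1` U = history k @^-1` [set a : k.-tuple X | U (foldl next s0 a)].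
  by apply/seteqP; split => t /=; rewrite run_history.
exact/measurable_preimage_finite/measurable_history.
Qed.

(** The Markov property: on an event determined by the current state, the next
    state may be averaged out. *)
Lemma integral_run_next k (G : St -> \bar R) (U : set St) :
  (forall s, 0 <= G s)%E ->
  (\int[Pr]_(t in run k @^-1` U) G (run k.+1 t) =
   \int[Pr]_(t in run k @^-1` U) expected_next G (run k t))%E.
Proof.
move=> G0; have mU := measurable_run_preimage k U.
have KG0 s : (0 <= expected_next G s)%E.
  by apply: sume_ge0 => x _; rewrite mule_ge0// lee_fin.
pose Y t := (history k t, xi k t).
have YE a x : Y @^-1` [set (a, x)] =
    history k @^-1` [set a] `&` xi k @^-1` [set x].
  by apply/seteqP; split => t /=; [case=> -> ->|case=> <- <-].
have mY i : measurable (Y @^-1` [set i]).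
  by case: i => a x; rewrite YE; apply: measurableI => //; exact: measurable_history.
pose st (a : k.-tuple X) := foldl next s0 a.
transitivity (\int[Pr]_(t in run k @^-1` U) G (next (st (Y t).1) (Y t).2))%E.
  by apply: eq_integral => t _; rewrite /= run_history.
rewrite (ge0_integral_finite_range _ mY Pr (fun i => G (next (st i.1) i.2)))//.
transitivity (\int[Pr]_(t in run k @^-1` U) expected_next G (st (history k t)))%E;
  last by apply: eq_integral => t _; rewrite run_history.
rewrite (ge0_integral_finite_range _ (measurable_history k) Pr
  (fun a => expected_next G (st a)))//.
transitivity (\sum_(a : k.-tuple X) \sum_(x : X) (G (next (st a) x) *
    Pr (run k @^-1` U `&` Y @^-1` [set (a, x)])))%E.
  by rewrite pair_bigA/=; apply: eq_bigr => -[a x] _.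
apply: eq_bigr => a _; rewrite /expected_next ge0_sume_distrl; last first.
  by move=> x _; rewrite mule_ge0// lee_fin.
apply: eq_bigr => x _; rewrite YE setIA.
have [Ua|nUa] := pselect (U (st a)).
  have -> : run k @^-1` U `&` history k @^-1` [set a] = history k @^-1` [set a].
    by apply/setIidPr => t /= ta; rewrite run_history ta.
  by rewrite history_independent muleCA muleA.
have -> : run k @^-1` U `&` history k @^-1` [set a] = set0.
  by rewrite -subset0 => t [/= + ta]; rewrite run_history ta.
by rewrite set0I !measure0 !mule0.
Qed.

(** If one step contracts [G] in mean by [r], then [k] steps do by [r ^+ k]. *)
Lemma integral_run_contraction (G : St -> \bar R) (r : R) k :
  (forall s, 0 <= G s)%E -> 0 <= r ->
  (forall s, expected_next G s <= r%:E * G s)%E ->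
  (\int[Pr]_t G (run k t) <= (r ^+ k)%:E * G s0)%E.
Proof.
move=> G0 r0 GK; elim: k => [|k IH].
  rewrite /= integral_cst// [X in (G s0 * X)%E](_ : _ = 1%E).
    by rewrite mule1 expr0 mul1e.
  exact: probability_setT.
have := integral_run_next k G setT G0; rewrite preimage_setT => ->.
apply: (@le_trans _ _ (\int[Pr]_t (r%:E * G (run k t)))%E).
  apply: ge0_le_integral => //.
  - by move=> t _; apply: sume_ge0 => x _; rewrite mule_ge0// lee_fin.
  - exact: measurable_run.
  - exact: (measurable_run k (fun s => r%:E * G s)%E).
rewrite ge0_integralZl//; last exact: measurable_run.
by rewrite exprS EFinM -muleA lee_wpmul2l// lee_fin.
Qed.

End random_iteration.

(** * The sampled gradient estimate *)

Section gradient_estimate.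
Context {R : realType} {d n : nat}.
Variable S : sampling R n.
Implicit Types A B : 'M[R]_(d, n).

Lemma sampled_mean A : unbiased S ->
  \sum_(s : sample S) prob s *: sampled A s = averaged A.
Proof.
move=> unb.
transitivity (n%:R^-1 *: (A *m ((\sum_(s : sample S)
    prob s *: (theta_mx s *m I_mx s)) *m ones R n))); last by rewrite unb.
rewrite mulmx_suml mulmx_sumr scaler_sumr; apply: eq_bigr => s _.
by rewrite /sampled -scalemxAl -scalemxAr !mulmxA scalerA mulrC -scalerA.
Qed.

Lemma averagedB A B : averaged (A - B) = averaged A - averaged B.
Proof. by rewrite /averaged mulmxBl scalerBr. Qed.

Lemma sampling_varianceN A : sampling_variance S (- A) = sampling_variance S A.
Proof.
apply: eq_bigr => s _; congr (_ * _).
have -> : sampled (- A) s - averaged (- A) = - (sampled A s - averaged A).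
  by rewrite /sampled /averaged !mulNmx !scalerN opprB opprK addrC.
by rewrite /sqnorm dotNl dotNr opprK.
Qed.

Variables (f : 'I_n -> 'cV[R]_d -> R) (c : constants R).
Hypothesis f_diff : forall i x, differentiable (f i) x.
Hypothesis prob1 : \sum_(s : sample S) prob s = 1.

Lemma gk_mean (st : state R d) : unbiased S ->
  \sum_(s : sample S) prob s *: gk f c st s = grad (favg f) (xk c st).
Proof.
move=> unb; rewrite grad_favg// /gk.
under eq_bigr do rewrite scalerDr.
rewrite big_split/= sampled_mean// -scaler_suml prob1 scale1r.
by rewrite averagedB subrK.
Qed.

Lemma gk_variance (st : state R d) :
  \sum_(s : sample S) prob s * sqnorm (gk f c st s - grad (favg f) (xk c st)) =
  sampling_variance S (Gmx f (wk st) - Gmx f (xk c st)).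
Proof.
rewrite -(opprB (Gmx f (xk c st))) sampling_varianceN.
apply: eq_bigr => s _; rewrite grad_favg// /gk averagedB.
by rewrite opprB addrA.
Qed.

End gradient_estimate.

(** * Decrease of the Lyapunov function *)

Section lyapunov_decrease.
Context {R : realType} {d n : nat}.
Variables (f : 'I_n -> 'cV[R]_d -> R) (psi : 'cV[R]_d -> \bar R).
Variables (S : sampling R n) (c : constants R) (xstar : 'cV[R]_d).
Hypothesis f_diff : forall i x, differentiable (f i) x.
Hypothesis psi_proper : proper_efun psi.
Hypothesis psi_closed : closed_efun psi.
Hypothesis xstar_min :
  forall x, (objective f psi xstar <= objective f psi x)%E.
Hypothesis S_unbiased : unbiased S.
Hypothesis prob_ge0 : forall s : sample S, 0 <= prob s.
Hypothesis prob1 : \sum_(s : sample S) prob s = 1.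
Hypothesis p01 : 0 < pw c <= 1.
Hypothesis Lf_gt0 : 0 < Lf c.
Hypothesis mu_f_ge0 : 0 <= mu_f c.
Hypothesis mu_psi_ge0 : 0 <= mu_psi c.
Hypothesis mu_gt0 : 0 < mu c.
Hypothesis f_smooth : convex_function (E := 'cV[R]_d) setT
    (fun x => Lf c / 2 * sqnorm x - favg f x).
Hypothesis f_convex : convex_function (E := 'cV[R]_d) setT
    (fun x => favg f x - mu_f c / 2 * sqnorm x).
Hypothesis psi_convex :
  convex_efun (fun x => psi x - (mu_psi c / 2 * sqnorm x)%:E)%E.
Hypothesis L2_gt0 : 0 < L2 c.
Hypothesis S_variance : forall x y : 'cV[R]_d,
  sampling_variance S (Gmx f x - Gmx f y) <=
  2 * L2 c * (favg f x - favg f y - dot (grad (favg f) y) (x - y)).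

Local Notation dom := (finite_dom psi).
Local Notation P u := (favg f u + fine (psi u)).

Lemma minimizer_finite_dom : dom xstar.
Proof.
have [x psix] := psi_proper.2.
apply: contrapT => /(notin_finite_dom _ psi_proper) e.
have := xstar_min x; rewrite /objective e addey// leye_eq.
by case: (psi x) psix.
Qed.

Lemma gap_dom u : dom u -> gap f psi xstar u = (P u - P xstar)%:E.
Proof.
move=> du; rewrite /gap /objective {1}(finite_domE _ _ du).
by rewrite {1}(finite_domE _ _ minimizer_finite_dom).
Qed.

Lemma gap_notin_dom u : ~ dom u -> gap f psi xstar u = +oo%E.
Proof.
move=> /(notin_finite_dom _ psi_proper) e; rewrite /gap /objective e addey//.
by rewrite (finite_domE _ _ minimizer_finite_dom).
Qed.

Lemma minimizer_le u : dom u -> P xstar <= P u.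
Proof.
move=> du; have := xstar_min u.
rewrite /objective (finite_domE _ _ du) (finite_domE _ _ minimizer_finite_dom).
by rewrite -!EFinD lee_fin.
Qed.

Lemma gap_ge0 u : (0 <= gap f psi xstar u)%E.
Proof.
have [du|ndu] := pselect (dom u); last by rewrite gap_notin_dom.
by rewrite gap_dom// lee_fin subr_ge0 minimizer_le.
Qed.

Let t1 := theta1_gt0 c p01 Lf_gt0 mu_gt0 L2_gt0.
Let t2 := theta2_gt0 c L2_gt0.
Let L0 := Lmax_gt0 c L2_gt0.
Let e0 : 0 < eta_ c := eta_gt0 c p01 Lf_gt0 mu_gt0 L2_gt0.
Let p0 : 0 < pw c. Proof. by case/andP: p01. Qed.

Lemma calZ_ge0 st : (0 <= calZ c xstar st)%E.
Proof.
rewrite lee_fin mulr_ge0 ?sqnorm_ge0// divr_ge0 ?mulr_ge0//; try exact: ltW.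
by rewrite addr_ge0// mulr_ge0 ?divr_ge0//; exact: ltW.
Qed.

Lemma calY_ge0 st : (0 <= calY f psi c xstar st)%E.
Proof. by rewrite mule_ge0 ?gap_ge0// lee_fin invr_ge0 ltW. Qed.

Lemma calW_coef_gt0 q : 0 < q -> 0 < theta2 c / (pw c * q * theta1 c).
Proof. by move=> q0; rewrite divr_gt0// !mulr_gt0. Qed.

Lemma calW_ge0 q st : 0 < q -> (0 <= calW f psi c xstar q st)%E.
Proof.
by move=> q0; rewrite mule_ge0 ?gap_ge0// lee_fin ltW// calW_coef_gt0.
Qed.

Lemma Psi_ge0 q st : 0 < q -> (0 <= Psi f psi c xstar q st)%E.
Proof. by move=> q0; rewrite !adde_ge0 ?calZ_ge0 ?calY_ge0 ?calW_ge0. Qed.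

Local Notation draw_law :=
  (fun x : sample S * bool => prob x.1 * bernoulli_pmf (pw c) x.2).
Local Notation draw_step :=
  (fun st (x : sample S * bool) => step f psi c st x.1 x.2).

(** The three-term recursion for one step of the method, averaged over the sample
    and the coin. *)
Lemma expected_Psi_step (q : R) (st : state R d) : 0 < q < 1 ->
  (expected_next draw_law draw_step (Psi f psi c xstar q) st <=
   ((1 + eta_ c * sigma c)^-1)%:E * calZ c xstar st
   + (1 - (theta1 c + theta2 c - theta2 c / q))%:E * calY f psi c xstar st
   + (1 - pw c * (1 - q))%:E * calW f psi c xstar q st)%E.
Proof.
move=> /andP[q0 q1].
have th1h := theta1_le_half c p01 L2_gt0.
have th2h := theta2_le_half c L2_gt0.
have cy0 : 0 < 1 - (theta1 c + theta2 c - theta2 c / q).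
  have : theta2 c < theta2 c / q by rewrite ltr_pdivlMr// gtr_pMr.
  by have := t2; lra.
have cw0 : 0 < 1 - pw c * (1 - q).
  rewrite subr_gt0; apply: (@le_lt_trans _ _ (1 - q)); last by lra.
  by rewrite ler_piMl//; [lra|case/andP: p01].
have lte_fin_ge0 (a : R) : 0 < a -> (0 <= a%:E)%E by rewrite lee_fin => /ltW.
have cz0 : (0 <= ((1 + eta_ c * sigma c)^-1)%:E * calZ c xstar st)%E.
  rewrite mule_ge0 ?calZ_ge0// lee_fin invr_ge0 addr_ge0// mulr_ge0 ?divr_ge0//;
  exact: ltW.
have tW0 := calW_coef_gt0 _ q0.
have cY0 := mule_ge0 (lte_fin_ge0 _ cy0) (calY_ge0 st).
have cW0 := mule_ge0 (lte_fin_ge0 _ cw0) (calW_ge0 _ st q0).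
(* if [psi] is infinite at [yk st] or [wk st], so is the right-hand side *)
have [dy|ndy] := pselect (dom (yk st)); last first.
  move: cz0 cW0; rewrite /calY gap_notin_dom// gt0_muley ?lte_fin ?invr_gt0//.
  rewrite gt0_muley ?lte_fin//.
  by move: (_ * calZ _ _ _)%E (_ * calW _ _ _ _ _ _)%E => [?||] [?||]//=;
    rewrite ?leey.
have [dw|ndw] := pselect (dom (wk st)); last first.
  move: cz0 cY0; rewrite /calW gap_notin_dom// gt0_muley ?lte_fin//.
  rewrite gt0_muley ?lte_fin//.
  by move: (_ * calZ _ _ _)%E (_ * calY _ _ _ _ _)%E => [?||] [?||]//=;
    rewrite ?leey.
(* the new [z] and [y] do not depend on the coin *)
pose z' (s : sample S) := zk (step f psi c st s true).
pose y' (s : sample S) := yk (step f psi c st s true).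
have smooth x y := @convexN_first_order _ _ (Lf c) (favg f) x y
  (differentiable_favg _ f x (fun i => f_diff i x)) f_smooth.
have convx x y := @convex_first_order _ _ (mu_f c) (favg f) x y
  (differentiable_favg _ f x (fun i => f_diff i x)) f_convex.
have th1lt1 : theta1 c < 1 by lra.
have th12 : theta1 c + theta2 c <= 1 by lra.
have step_dom (s : sample S) := prox_step_bound (favg f) psi (mu_psi c) (Lf c) xstar
  psi_proper psi_closed mu_psi_ge0 psi_convex smooth minimizer_finite_dom minimizer_le
  (Lmax c) (mu_f c) (theta1 c) (theta2 c) L0 (Lf_le_Lmax c) mu_f_ge0 t1 th1lt1
  (ltW t2) th12 (xk c st) (yk st) (zk st) (wk st) (gk f c st s) dy dw erefl.
have variance := S_variance (wk st) (xk c st).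
rewrite -gk_variance// in variance.
have main := prox_step_mean (favg f) psi (mu_psi c) (Lf c) xstar
  psi_proper psi_closed mu_psi_ge0 psi_convex smooth minimizer_finite_dom minimizer_le
  (Lmax c) (mu_f c) (theta1 c) (theta2 c) L0 (Lf_le_Lmax c) mu_f_ge0 t1 th1lt1
  (ltW t2) th12 convx (sample S) (@prob _ _ S) (gk f c st) z' y' (L2 c)
  (xk c st) (yk st) (zk st) (wk st) prob_ge0 prob1
  (gk_mean S f c f_diff prob1 st S_unbiased) variance erefl dy dw erefl
  (fun=> erefl) (fun=> erefl).
pose A s := Lmax c * (1 + eta_ c * sigma c) / (2 * eta_ c) *
    sqnorm (z' s - xstar) + (theta1 c)^-1 * (P (y' s) - P xstar).
pose W (b : bool) := theta2 c / (pw c * q * theta1 c) *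
    (P (if b then yk st else wk st) - P xstar).
have PsiE s b : Psi f psi c xstar q (step f psi c st s b) = (A s + W b)%:E.
  have [_ dy' _] := step_dom s.
  rewrite /Psi /calZ /calY /calW (gap_dom _ dy') gap_dom; last by case: b.
  by rewrite -!EFinM -!EFinD.
have -> : expected_next draw_law draw_step (Psi f psi c xstar q) st =
    (\sum_(s : sample S) prob s * A s + pw c * W true + (1 - pw c) * W false)%:E.
  rewrite /expected_next; under eq_bigr do rewrite PsiE -EFinM.
  rewrite sumEFin; congr (_%:E).
  rewrite -(pair_bigA _ (fun s b => prob s * bernoulli_pmf (pw c) b *
    (A s + W b)))/=.
  transitivity (\sum_(s : sample S) (prob s * A s +
      prob s * (pw c * W true + (1 - pw c) * W false))).
    by apply: eq_bigr => s _; rewrite big_bool /bernoulli_pmf/=; ring.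
  by rewrite big_split/= -mulr_suml prob1 mul1r addrA.
rewrite /calZ /calY /calW !gap_dom// -!EFinM -!EFinD lee_fin.
apply: (@le_trans _ _ (Lmax c / (2 * eta_ c) * sqnorm (zk st - xstar)
     + (1 - theta1 c - theta2 c) / theta1 c * (P (yk st) - P xstar)
     + theta2 c / theta1 c * (P (wk st) - P xstar)
     + pw c * W true + (1 - pw c) * W false)).
  by rewrite !lerD2r; exact: main.
have es0 : 0 < 1 + eta_ c * sigma c.
  by rewrite ltr_pwDl// mulr_ge0 ?divr_ge0//; exact: ltW.
(* as [pw c] times the coefficient of the [w]-part is [theta2 / (q * theta1)],
   the gap at [wk st] left by the averaged step is [pw c * q] times the [w]-part,
   and the coin adds [theta2 / q] times the [y]-part *)
rewrite le_eqVlt; apply/orP; left; apply/eqP; rewrite /W /=.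
move: (P _ - P _) (P _ - P _) (sqnorm _) => u v r.
by field; rewrite !gt_eqF.
Qed.

Lemma expected_Psi_contraction (st : state R d) :
  (expected_next draw_law draw_step (Psi f psi c xstar (balance c)) st <=
   (1 - rate c / 6)%:E * Psi f psi c xstar (balance c) st)%E.
Proof.
have /andP[q23 q1] := balance_bounds c p01 Lf_gt0 mu_gt0 L2_gt0.
have q0 : 0 < balance c by lra.
have q01 : 0 < balance c < 1 by rewrite q0.
apply: (le_trans (expected_Psi_step _ st q01)).
have Z0 := calZ_ge0 st; have Y0 := calY_ge0 st; have W0 := calW_ge0 _ st q0.
rewrite [in leRHS]/Psi ge0_muleDr ?adde_ge0// ge0_muleDr//.
have := contraction_z c p01 Lf_gt0 mu_gt0 L2_gt0.
have := contraction_y c p01 Lf_gt0 mu_gt0 L2_gt0.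
have := contraction_w c p01 Lf_gt0 mu_gt0 L2_gt0.
by move=> *; rewrite !leeD// lee_wpmul2r// lee_fin.
Qed.

End lyapunov_decrease.

(** * Independent draws and the iterates *)

Section draws.
Context {R : realType} {n : nat} {dsp : measure_display}.
Context {T : measurableType dsp} (Pr : probability T R).
Variables (S : sampling R n) (p : R).
Variables (S_ : nat -> T -> sample S) (B_ : nat -> T -> bool).
Hypothesis draws : independent_draws Pr p S_ B_.

Lemma measurable_draws k (x : sample S * bool) :
  measurable ((fun t => (S_ k t, B_ k t)) @^-1` [set x]).
Proof.
have [mS mB _] := draws; case: x => s b.
have -> : (fun t => (S_ k t, B_ k t)) @^-1` [set (s, b)] =
    S_ k @^-1` [set s] `&` B_ k @^-1` [set b].
  by apply/seteqP; split => t /=; [case=> -> ->|case=> <- <-].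
exact: measurableI.
Qed.

(** The indices below [k] as a finite set, the form in which independence gives
    the law of the first [k] draws. *)
Fixpoint initial_fset (k : nat) : {fset nat} :=
  if k is k'.+1 then (k' |` initial_fset k')%fset else fset0.

Lemma mem_initial_fset k j : (j \in initial_fset k) = (j < k)%N.
Proof.
elim: k => [|k IH]; first by rewrite in_fset0.
by rewrite in_fset1U IH [RHS]ltnS [RHS]leq_eqVlt.
Qed.

Lemma draws_independent k (a : nat -> sample S * bool) :
  Pr [set t | forall j, (j < k.+1)%N -> (S_ j t, B_ j t) = a j] =
  ((prob (a k).1 * bernoulli_pmf p (a k).2)%:E *
   Pr [set t | forall j, (j < k)%N -> (S_ j t, B_ j t) = a j])%E.
Proof.
have PrE m : Pr [set t | forall j, (j < m)%N -> (S_ j t, B_ j t) = a j] =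
    ((\prod_(j <- initial_fset m) prob (a j).1) *
     (\prod_(j <- initial_fset m) bernoulli_pmf p (a j).2))%:E.
  have [_ _ <-] := draws; congr (Pr _); apply/seteqP; split => t /=.
    by move=> h; split => j /=; rewrite mem_initial_fset => /h <-.
  move=> [hS hB] j jm; rewrite [RHS]surjective_pairing.
  by rewrite -(hS j) -?(hB j)//= mem_initial_fset.
rewrite !PrE -EFinM; congr (_%:E) => /=.
by rewrite !big_fsetU1 ?mem_initial_fset ?ltnn//= mulrACA.
Qed.

Lemma prob_draw (s : sample S) : (prob s)%:E = Pr (S_ 0 @^-1` [set s]).
Proof.
have [_ _ /(_ [fset 0%N]%fset fset0 (fun=> s) (fun=> true))] := draws.
rewrite !big_seq_fset1 big_nil mulr1 => <-; congr (Pr _).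
apply/seteqP; split => t /=.
  by move=> [h _]; apply: (h 0%N); rewrite /= inE.
by move=> h; split => j; rewrite /= inE// => /eqP ->.
Qed.

Lemma draw_prob_ge0 (s : sample S) : 0 <= prob s.
Proof. by rewrite -lee_fin prob_draw. Qed.

Lemma draw_prob1 : \sum_(s : sample S) prob s = 1.
Proof.
have [mS _ _] := draws; apply: EFin_inj; rewrite -sumEFin.
transitivity (\int[Pr]_t (cst 1%E t))%E; last first.
  by rewrite integral_cst// mul1e; exact: probability_setT.
rewrite (ge0_integral_finite_range (S_ 0) (mS 0%N) Pr (cst 1%E))//.
by apply: eq_bigr => s _; rewrite setTI mul1e prob_draw.
Qed.

End draws.

Lemma iterates_run (R : realType) (d n : nat) (f : 'I_n -> 'cV[R]_d -> R)
    (psi : 'cV[R]_d -> \bar R) (S : sampling R n) (c : constants R)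
    (v0 : 'cV[R]_d) (dsp : measure_display) (T : measurableType dsp)
    (S_ : nat -> T -> sample S) (B_ : nat -> T -> bool) k t :
  iterates f psi c v0 (S_ ^~ t) (B_ ^~ t) k =
  run (fun j t => (S_ j t, B_ j t)) (fun st x => step f psi c st x.1 x.2)
    (State v0 v0 v0) k t.
Proof. by elim: k => //= k ->. Qed.

Theorem theorem3p2 (R : realType) :
  exists C : R, 0 < C /\
  forall (d n : nat) (f : 'I_n -> 'cV[R]_d -> R) (psi : 'cV[R]_d -> \bar R)
    (S : sampling R n) (c : constants R) (xstar v0 : 'cV[R]_d)
    (dsp : measure_display) (T : measurableType dsp) (Pr : probability T R)
    (S_ : nat -> T -> sample S) (B_ : nat -> T -> bool),
  (0 < n)%N ->
  (forall i x, differentiable (f i) x) ->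
  proper_efun psi -> closed_efun psi -> convex_efun psi ->
  (forall x, (objective f psi xstar <= objective f psi x)%E) ->
  sampling_spec S -> unbiased S ->
  0 < pw c <= 1 ->
  0 < Lf c -> 0 <= mu_f c -> 0 <= mu_psi c -> 0 < mu c ->
  convex_function (E := 'cV[R]_d) setT
    (fun x => Lf c / 2 * sqnorm x - favg f x) ->
  convex_function (E := 'cV[R]_d) setT
    (fun x => favg f x - mu_f c / 2 * sqnorm x) ->
  convex_efun (fun x => psi x - (mu_psi c / 2 * sqnorm x)%:E)%E ->
  0 < L2 c ->
  (forall x y : 'cV[R]_d,
     sampling_variance S (Gmx f x - Gmx f y) <=
     2 * L2 c * (favg f x - favg f y - dot (grad (favg f) y) (x - y))) ->
  independent_draws Pr (pw c) S_ B_ ->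
  let st k t := iterates f psi c v0 (S_ ^~ t) (B_ ^~ t) k in
  let Z := calZ c xstar in
  let Y := calY f psi c xstar in
  let W := calW f psi c xstar in
  (forall (q : R) (k : nat) (s : state R d), 0 < q < 1 ->
     let A := [set t | st k t = s] in
     (0 < Pr A)%E ->
     (cond_mean Pr
        (fun t => Z (st k.+1 t) + Y (st k.+1 t) + W q (st k.+1 t)) A
      <= ((1 + eta_ c * sigma c)^-1)%:E * Z s
         + (1 - (theta1 c + theta2 c - theta2 c / q))%:E * Y s
         + (1 - pw c * (1 - q))%:E * W q s)%E) /\
  (exists q : R, 2 / 3 <= q < 1 /\
     forall (eps : R) (k : nat), 0 < eps < 1 ->
       C * ((pw c)^-1 + Num.sqrt (Lf c / mu c)
            + Num.sqrt (L2 c / (mu c * pw c))) * ln (eps^-1) <= k%:R ->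
       (mean Pr (fun t => Psi f psi c xstar q (st k t))
        <= eps%:E * Psi f psi c xstar q (State v0 v0 v0))%E).
Proof.
exists 6; split; first by [].
move=> d n f psi S c xstar v0 dsp T Pr S_ B_ _ f_diff psi_proper psi_closed _
  xstar_min _ S_unbiased p01 Lf_gt0 mu_f_ge0 mu_psi_ge0 mu_gt0 f_smooth f_convex
  psi_convex L2_gt0 S_variance draws st Z Y W.
have prob_ge0 := draw_prob_ge0 Pr S (pw c) S_ B_ draws.
have prob1 := draw_prob1 Pr S (pw c) S_ B_ draws.
pose xi k t := (S_ k t, B_ k t).
pose law (x : sample S * bool) := prob x.1 * bernoulli_pmf (pw c) x.2.
pose next (s : state R d) (x : sample S * bool) := step f psi c s x.1 x.2.
pose s0 : state R d := State v0 v0 v0.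
have law_ge0 x : 0 <= law x.
  case/andP: p01 => p0 p1.
  by rewrite mulr_ge0// bernoulli_pmf_ge0// (ltW p0).
have xi_measurable := measurable_draws Pr S (pw c) S_ B_ draws.
have xi_independent := draws_independent Pr S (pw c) S_ B_ draws.
have stE k : st k = run xi next s0 k.
  by apply/funext => t; rewrite /st iterates_run.
have Psi0 q s : 0 < q -> (0 <= Psi f psi c xstar q s)%E.
  exact: Psi_ge0.
split.
  move=> q k s q01 A A_gt0.
  have q0 : 0 < q by case/andP: q01.
  have AE : A = run xi next s0 k @^-1` [set s].
    by rewrite /A stE.
  have mA : measurable A by rewrite AE; exact: measurable_run_preimage.
  have -> : cond_mean Pr
      (fun t => Z (st k.+1 t) + Y (st k.+1 t) + W q (st k.+1 t))%E A =
      expected_next law next (Psi f psi c xstar q) s.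
    rewrite /cond_mean.
    have -> : (\int[Pr]_(t in A)
        (Z (st k.+1 t) + Y (st k.+1 t) + W q (st k.+1 t)) =
        expected_next law next (Psi f psi c xstar q) s * Pr A)%E.
      rewrite -integral_cst// {1}AE stE.
      rewrite (integral_run_next Pr xi law next s0 law_ge0 xi_measurable
        xi_independent k (Psi f psi c xstar q) [set s] (fun s => Psi0 q s q0)).
      by rewrite -AE; apply: eq_integral => t; rewrite inE AE /= => ->.
    rewrite muleCA -[X in (_ * (_ * X))%E]fineK ?fin_num_measure//.
    rewrite -EFinM mulVf ?mule1//.
    by rewrite gt_eqF// fine_gt0// A_gt0 ltey_eq fin_num_measure.
  exact: expected_Psi_step.
exists (balance c); have /andP[q23 q1] := balance_bounds c p01 Lf_gt0 mu_gt0 L2_gt0.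
split; first by rewrite q23.
move=> eps k eps01 hk.
have r1 := rate_le1 c p01 Lf_gt0 mu_gt0 L2_gt0.
have q0 : 0 < balance c by lra.
have r0 : 0 <= 1 - rate c / 6 by lra.
rewrite /mean stE.
apply: (le_trans (integral_run_contraction Pr xi law next s0 law_ge0 xi_measurable
  xi_independent (Psi f psi c xstar (balance c)) _ k (fun s => Psi0 _ s q0) r0 _)).
  by move=> s; exact: expected_Psi_contraction.
apply: lee_wpmul2r; first exact: Psi0.
rewrite lee_fin; apply: rate_complexity => //.
by rewrite /rate invrK.
Qed.
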